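(* Consider a primitive, aperiodic substitution tiling of $\mathbb{R}^d$ ($d\ge1$) with finite local complexity, with canonical transversal $\Xi$ equipped with its ultrametric $\rho$. Then the abscissa of convergence $s_0$ of the zeta-function of $\Xi$ is equal to the Hausdorff dimension $\dim_H(\Xi)$ of $(\Xi,\rho)$, and moreover $$s_0=\dim_H(\Xi)=d.$$
   Context: Substitution tilings of $\mathbb{R}^d$: let $\mathcal{A}$ be a finite set of prototiles, each a compact subset of $\mathbb{R}^d$ homeomorphic to a closed ball, containing the origin in its interior, and possibly carrying a label (to distinguish prototiles of the same shape). A tile is a translate $p+x$ of a prototile $p$ (keeping its label), and $x$ is called its puncture. A patch is a set of tiles with pairwise disjoint interiors; a tiling is a patch whose tiles cover $\mathbb{R}^d$. A substitution with expansion factor $\lambda>1$ assigns to each $p\in\mathcal{A}$ a finite patch $\omega(p)$ whose tiles have union $\lambda p$; it is extended to tiles by $\omega(p+x)=\omega(p)+\lambda x$, and to patches by taking unions, so iterates $\omega^n(p)$ are defined. The tiling space $\Omega$ is the set of tilings all of whose finite subpatches are, up to translation, contained in some $\omega^n(p)$, $n\in\mathbb{N}$, $p\in\mathcal{A}$. Let $A_{pq}$ ($p,q\in\mathcal{A}$) be the number of translates of $p$ in $\omega(q)$. The substitution is primitive if some power of $A$ has all entries positive. Finite local complexity: for every $R>0$, the tilings of $\Omega$ contain, up to translation, only finitely many patches of diameter at most $R$. Aperiodic: no $T\in\Omega$ satisfies $T+x=T$ for a nonzero $x\in\mathbb{R}^d$. The canonical transversal is $\Xi=\{T\in\Omega:\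 0\text{ is the puncture of a tile of }T\}$. Its ultrametric is $\rho(T,T)=0$ and, for $T\ne T'$, $\rho(T,T')=1/(1+R)$, where $R$ is the supremum of all $r\ge0$ such that $T$ and $T'$ have exactly the same tiles meeting the closed ball of radius $r$ centred at $0$ (with $R=0$ if there is no such $r$). Zeta-function of $\Xi$: let $\Lambda$ be the Perron–Frobenius eigenvalue of $A$ and $(\nu_p)_{p\in\mathcal{A}}$ the positive eigenvector $A\nu=\Lambda\nu$ normalized by $\sum_p\nu_p=1$. The Bratteli diagram of the substitution has a root $\circ$ at level $0$, a copy of $\mathcal{A}$ at each level $n\ge1$, one edge from $\circ$ to each vertex of level $1$, and $A_{pq}$ edges from $p$ at level $n$ to $q$ at level $n+1$, for all $n\ge1$. Let $\Pi$ be the set of finite paths starting at the root, $|\gamma|$ the number of edges of $\gamma\in\Pi$ and $r(\gamma)$ its final vertex. Put $\operatorname{diam}[\gamma]=(\nu_{r(\gamma)})^{1/d}\Lambda^{-|\gamma|/d}$ for $|\gamma|\ge1$, and $\operatorname{diam}[\gamma]=1$ for the empty path. Then $$\zeta(s)=\sum_{\gamma\in\Pi}\operatorname{diam}[\gamma]^s .$$ Its abscissa of convergence is the real number $s_0>0$ such that the series defines a holomorphic function on $\Re(s)>s_0$ which is singular at $s_0$ (has no holomorphic extension to a neighbourhood of $s_0$). *)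

(* Defs.v *)
From HB Require Import structures.
From mathcomp Require Import all_boot all_order all_algebra finmap.
From mathcomp Require Import complex.
From mathcomp Require Import all_classical all_reals all_analysis.
From mathcomp Require Import summability.
Set Implicit Arguments.
Unset Strict Implicit.
Unset Printing Implicit Defensive.
Import Order.TTheory GRing.Theory Num.Theory.
Import numFieldNormedType.Exports.
Local Open Scope classical_set_scope.
Local Open Scope ring_scope.

(* The library norm on ['rV[R]_d] is the sup norm; it induces the usual
   topology, but balls and diameters below are Euclidean. *)
Definition enorm (R : realType) (d : nat) (x : 'rV[R]_d) : R :=
  Num.sqrt (\sum_(i < d) x ord0 i ^+ 2).

Definition eball (R : realType) (d : nat) (r : R) : set 'rV[R]_d :=
  [set y | enorm y <= r].

Definition edist (R : realType) (d : nat) (x y : 'rV[R]_d) : R := enorm (x - y).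

Definition homeomorphic_sets (X Y : topologicalType) (A : set X) (B : set Y) :=
  exists (f : X -> Y) (g : Y -> X),
    [/\ {within A, continuous f}, {within B, continuous g},
        f @` A `<=` B, g @` B `<=` A
      & (forall x, A x -> g (f x) = x) /\ (forall y, B y -> f (g y) = y)].

(* [maxe 0] makes the diameter of the empty set equal to 0. *)
Definition diameter (R : realType) (X : Type) (dist : X -> X -> R) (U : set X)
    : \bar R :=
  maxe 0%E (ereal_sup [set (dist u.1 u.2)%:E | u in U `*` U]).

(* ** Hausdorff dimension of [E] with the distance [dist] *)

Section Hausdorff.
Variables (R : realType) (X : Type) (dist : X -> X -> R).
Local Open Scope ereal_scope.

(* [poweR] satisfies 0 `^ 0 = 1, so the empty set needs its own case for the
   0-dimensional measure to be the counting measure. *)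
Definition hausdorff_weight (s : R) (U : set X) : \bar R :=
  if `[< U = set0 >] then 0 else poweR (diameter dist U) s.

Definition hausdorff_premeasure (s delta : R) (E : set X) : \bar R :=
  ereal_inf [set \sum_(0 <= i <oo) hausdorff_weight s (U i) |
    U in [set U : nat -> set X |
      [/\ forall i, U i `<=` E, E `<=` \bigcup_i U i
        & forall i, diameter dist (U i) <= delta%:E]]].

Definition hausdorff_measure (s : R) (E : set X) : \bar R :=
  ereal_sup [set hausdorff_premeasure s delta E |
    delta in [set delta : R | (0 < delta)%R]].

Definition hausdorff_dim (E : set X) : \bar R :=
  ereal_inf [set s%:E |
    s in [set s : R | (0 <= s)%R /\ hausdorff_measure s E = 0]].

End Hausdorff.

(* ** Tiles and substitutions *)

(* A finite set of [k] prototiles.  Prototiles are referred to by their index,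
   which plays the role of the label: two indices may carry the same shape. *)
Record prototiles (R : realType) (d k : nat) := Prototiles {
  shape :> 'I_k -> set 'rV[R]_d ;
  shape_compact : forall p, compact (shape p) ;
  shape_ball : forall p, homeomorphic_sets (shape p) (@eball R d 1) ;
  shape_origin : forall p, (interior (shape p)) 0 }.

Definition tile (R : realType) (d k : nat) : Type := ('I_k * 'rV[R]_d)%type.
HB.instance Definition _ (R : realType) (d k : nat) :=
  Choice.on (tile R d k).

Section Tilings.
Variables (R : realType) (d k : nat).
Local Notation tile := (tile R d k).

(* The tile [(p, x)] stands for the translate p + x; its puncture is [x]. *)
Definition puncture (t : tile) : 'rV[R]_d := t.2.

Definition support (P : prototiles R d k) (t : tile) : set 'rV[R]_d :=
  [set y + puncture t | y in P t.1].

Definition supports (P : prototiles R d k) (Q : set tile) : set 'rV[R]_d :=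
  \bigcup_(t in Q) support P t.

Definition is_patch (P : prototiles R d k) (Q : set tile) :=
  forall t u, Q t -> Q u -> t <> u ->
    interior (support P t) `&` interior (support P u) = set0.

Definition is_tiling (P : prototiles R d k) (T : set tile) :=
  is_patch P T /\ supports P T = setT.

Definition translate (x : 'rV[R]_d) (Q : set tile) : set tile :=
  [set (t.1, t.2 + x) | t in Q].

End Tilings.

Record substitution (R : realType) (d k : nat) := Substitution {
  protos :> prototiles R d k ;
  expansion : R ;
  omega : 'I_k -> {fset tile R d k} ;
  expansion_gt1 : 1 < expansion ;
  omega_patch : forall p, is_patch protos [set` omega p] ;
  omega_support : forall p,
    supports protos [set` omega p] = [set expansion *: y | y in protos p] }.

Section Substitution.
Variables (R : realType) (d k : nat) (S : substitution R d k).
Local Notation tile := (tile R d k).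

Definition omega_tile (t : tile) : set tile :=
  translate (expansion S *: puncture t) [set` omega S t.1].

Definition omega_patches (Q : set tile) : set tile :=
  \bigcup_(t in Q) omega_tile t.

Definition omega_iter (n : nat) (p : 'I_k) : set tile :=
  iter n omega_patches [set (p, 0)].

Definition tiling_space : set (set tile) :=
  [set T | is_tiling S T /\
    forall Q : set tile, finite_set Q -> Q `<=` T ->
      exists x n p, translate x Q `<=` omega_iter n p].

Definition subst_matrix : 'M[nat]_k :=
  \matrix_(p, q) #|` [fset t in omega S q | t.1 == p]%fset |.

Definition primitive_subst :=
  exists2 n, (0 < n)%N & forall p q, (0 < (subst_matrix ^+ n) p q)%N.

Definition finite_local_complexity :=
  forall r : R, 0 < r ->
    exists2 F : set (set tile), finite_set F &
      forall T Q, tiling_space T -> Q `<=` T ->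
        (diameter (@edist R d) (supports S Q) <= r%:E)%E ->
        exists2 Q', F Q' & exists x, Q = translate x Q'.

Definition aperiodic_subst :=
  forall T, tiling_space T -> forall x, x != 0 -> translate x T <> T.

Definition canonical_transversal : set (set tile) :=
  [set T | tiling_space T /\ exists2 t, T t & puncture t = 0].

Definition tiles_meeting (r : R) (T : set tile) : set tile :=
  [set t | T t /\ support S t `&` @eball R d r !=set0].

(* [sup set0 = 0], which is the required convention. *)
Definition agreement_radius (T T' : set tile) : R :=
  sup [set r | 0 <= r /\ tiles_meeting r T = tiles_meeting r T'].

Definition transversal_dist (T T' : set tile) : R :=
  if `[< T = T' >] then 0 else 1 / (1 + agreement_radius T T').

End Substitution.

(* ** Perron-Frobenius data of the substitution matrix *)

(* A real eigenvalue that dominates the modulus of all complex eigenvalues. *)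
Definition perron_eigenvalue (R : realType) (k : nat) (M : 'M[R]_k)
    (Lambda : R) :=
  eigenvalue M Lambda /\
  forall z : R[i], eigenvalue (map_mx (real_complex R) M) z ->
    `|z| <= real_complex R Lambda.

Definition perron_data (R : realType) (k : nat) (A : 'M[nat]_k)
    (Lambda : R) (nu : 'cV[R]_k) :=
  let M := map_mx (fun n : nat => n%:R : R) A in
  [/\ perron_eigenvalue M Lambda, M *m nu = Lambda *: nu,
      forall p, 0 < nu p ord0 & \sum_p nu p ord0 = 1].

(* ** Paths in the Bratteli diagram with edge multiplicities [A] *)

Section Bratteli.
Variables (k : nat) (A : 'M[nat]_k).

Definition edge : Type := {pq : 'I_k * 'I_k & 'I_(A pq.1 pq.2)}.
HB.instance Definition _ := Finite.on edge.

Definition edge_src (e : edge) : 'I_k := (tag e).1.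
Definition edge_tgt (e : edge) : 'I_k := (tag e).2.

Fixpoint composable (p : 'I_k) (es : seq edge) : bool :=
  if es is e :: es' then (edge_src e == p) && composable (edge_tgt e) es'
  else true.

(* [None] is the empty path at the root.  A nonempty path consists of its level
   1 vertex [p], reached by the only edge from the root to [p], followed by the
   edges between later levels. *)
Definition bpath : Type :=
  option {g : 'I_k * seq edge | composable g.1 g.2}.
HB.instance Definition _ := Choice.on bpath.

Definition path_diam (R : realType) (d : nat) (Lambda : R) (nu : 'cV[R]_k)
    (g : bpath) : R :=
  if g is Some h then
    let: (p, es) := val h in
    let len := (size es).+1 in
    let r := last p (map edge_tgt es) in
    powR (nu r ord0) (1 / d%:R) * powR Lambda (- (len%:R / d%:R))
  else 1.

End Bratteli.

(* ** Zeta-functions *)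

Section Zeta.
Variable R : realType.

(* t ^ s = exp (s ln t), for t > 0 *)
Definition cpow (t : R) (s : R[i]) : R[i] :=
  let a := complex.Re s * ln t in
  let b := complex.Im s * ln t in
  (expR a * cos b +i* (expR a * sin b))%C.

(* The regular module [R[i]^o] carries the topology and the complex
   differentiable structure of the complex plane. *)
Definition holomorphic_on (U : set R[i]^o) (f : R[i]^o -> R[i]^o) :=
  forall z, U z -> derivable f z 1.

Variables (I : choiceType) (w : I -> R).

Definition zeta_term (s : R[i]) (g : I) : R[i]^o := cpow (w g) s.

(* Unordered summation over [I]. *)
Definition zeta (s : R[i]^o) : R[i]^o := sum (zeta_term s).

Definition half_plane (s0 : R) : set R[i]^o := [set s | s0 < complex.Re s].

Definition is_abscissa (s0 : R) :=
  [/\ 0 < s0,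
      forall s, half_plane s0 s -> cvg (partial_sum (zeta_term s) @ totally),
      holomorphic_on (half_plane s0) zeta
    & ~ exists (U : set R[i]^o) (f : R[i]^o -> R[i]^o),
        [/\ open U, U (real_complex R s0), holomorphic_on U f
          & forall s, U s -> half_plane s0 s -> f s = zeta s]].

End Zeta.

(* Main.v *)
(** Let [lam] be the expansion factor.  A level-[n] supertile covers a set of
    volume about [lam ^ (n d)]; packing and covering by cubes show that it
    contains between [(c lam ^ n) ^ d] and [(C lam ^ n) ^ d] tiles, and comparing
    with [A ^ n nu = Lambda ^ n nu] gives [Lambda = lam ^ d].  At [s = d] the paths
    of each length [m >= 1] contribute exactly [1 / Lambda] to the zeta-function, so
    the series diverges there (and is unbounded along real [s -> d+], which excludes
    an extension), while for [s > d] it is dominated by a geometric series.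

    Upper bound for the dimension: by finite local complexity a patch of radius
    [lam ^ n] around a puncture sits in one of finitely many clusters of level-[n]
    supertiles, so there are [O(lam ^ (n d))] of them, and each defines a subset of
    the transversal of diameter at most [lam ^ -n].

    Lower bound: some tile reappears in the interior of a power of the substitution
    of itself, which yields a self-similar tiling [T0].  Primitivity makes [T0]
    linearly repetitive, and linear repetitivity together with aperiodicity makes it
    repulsive: a patch of radius [r] recurs only at distance at least [c (1 + r)].
    Hence among the [~ lam ^ (n d)] punctures of a large supertile of [T0] at most a
    fraction [C (1 + r) ^ -d] can belong to a given cylinder of radius [r].  Any cover
    of the transversal can be replaced by finitely many cylinders, by compactness, so
    it satisfies [sum diam ^ d >= kappa > 0]. *)

Require Import Defs.
From mathcomp Require Import all_boot all_order all_algebra finmap.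
From mathcomp Require Import complex.
From mathcomp Require Import all_classical all_reals all_analysis.
From mathcomp Require Import summability zify ring lra.
Set Implicit Arguments.
Unset Strict Implicit.
Unset Printing Implicit Defensive.
Import Order.TTheory GRing.Theory Num.Theory.
Import numFieldNormedType.Exports.
Local Open Scope classical_set_scope.
Local Open Scope ring_scope.
(* [GRing.Theory] rebinds [support]. *)
Local Notation support := Defs.support.

(** * Norms, packing and covering in [R^d] *)

Section Norms.
Variables (R : realType) (d : nat).
Implicit Types (x y : 'rV[R]_d).

Lemma norm_coord_le x i : `|x ord0 i| <= `|x|.
Proof.
rewrite [leRHS]/Num.norm/= mx_normrE.
by apply: (le_bigmax _ (fun ij : 'I_1 * 'I_d => `|x ij.1 ij.2|) (ord0, i)).
Qed.

Lemma row_norm_le x e : 0 <= e -> (forall i, `|x ord0 i| <= e) -> `|x| <= e.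
Proof.
move=> e0 xe; rewrite [leLHS]/Num.norm/= mx_normrE.
by apply/bigmax_leP; split=> // -[i j] _ /=; rewrite ord1.
Qed.

Lemma row_norm_lt x e : 0 < e -> (forall i, `|x ord0 i| < e) -> `|x| < e.
Proof.
move=> e0 xe; rewrite [ltLHS]/Num.norm/= mx_normrE.
by apply/bigmax_ltP; split=> // -[i j] _ /=; rewrite ord1.
Qed.

Lemma norm_le_enorm x : `|x| <= enorm x.
Proof.
apply: row_norm_le => [|i]; first exact: sqrtr_ge0.
rewrite -sqrtr_sqr ler_sqrt ?sumr_ge0// => [|j _]; last exact: sqr_ge0.
by rewrite (bigD1 i)//= lerDl sumr_ge0// => j _; exact: sqr_ge0.
Qed.

Lemma enorm_le x : enorm x <= d%:R * `|x|.
Proof.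
have dx0 : 0 <= d%:R * `|x| by rewrite mulr_ge0.
rewrite -(ger0_norm dx0) -sqrtr_sqr ler_sqrt ?sqr_ge0//.
apply: (@le_trans _ _ (\sum_(i < d) `|x| ^+ 2)).
  apply: ler_sum => i _; rewrite -real_normK ?num_real//.
  by rewrite lerXn2r ?nnegrE//; exact: norm_coord_le.
rewrite sumr_const card_ord -[leLHS]mulr_natl exprMn.
rewrite ler_wpM2r ?sqr_ge0// -natrX ler_nat.
by case: (d) => // n; rewrite leq_pmulr.
Qed.

Lemma interior_ballP (A : set 'rV[R]_d) x :
  interior A x <-> exists2 e, 0 < e & forall y, `|y - x| < e -> A y.
Proof.
split=> [/nbhs_ballP[e e0 eA]|[e e0 eA]].
  by exists e => // y yx; apply: eA; rewrite -ball_normE/= distrC.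
by apply/nbhs_ballP; exists e => // y; rewrite -ball_normE/= distrC => /eA.
Qed.

(** A finite Baire argument, by induction on the list: either [O] lies in the first closed set, or
    the nonempty open set [O] minus that set is covered by the remaining ones. *)
Lemma finite_closed_cover_interior (T : eqType) (s : seq T)
    (C : T -> set 'rV[R]_d) (O : set 'rV[R]_d) :
  (forall t, closed (C t)) -> open O -> O !=set0 ->
  (forall x, O x -> exists2 t, t \in s & C t x) ->
  exists t x, [/\ t \in s, O x & interior (C t) x].
Proof.
move=> Ccl; elim: s O => [|t s ih] O Oop [x Ox] Ocov.
  by have [] := Ocov _ Ox.
have [[y [Oy Cy]]|H] := pselect (O `&` ~` C t !=set0).
  have [||z [Oz Cz]|u [z [us [Oz _] Cz]]] := ih (O `&` ~` C t).
  - by apply: openI => //; exact: closed_openC.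
  - by exists y.
  - have [u] := Ocov _ Oz; rewrite inE => /orP[/eqP->//|us Cu].
    by exists u.
  - by exists u, z; split=> //; rewrite inE us orbT.
exists t, x; split=> //; first by rewrite inE eqxx.
rewrite /interior; move: Oop; rewrite openE => /(_ _ Ox).
apply: filterS => z Oz; apply: contrapT => Cz.
by apply: H; exists z.
Qed.

End Norms.

Lemma truncn_le_self (R : realType) (x : R) : 0 <= x -> (Num.truncn x)%:R <= x.
Proof. by rewrite truncn_le. Qed.

Section Packing.
Variables (R : realType) (d : nat) (T : choiceType) (f : T -> 'rV[R]_d).
Implicit Types (s : seq T) (A : set T).

(** Pigeonhole on grid cells of side [eps]: two points in one cell are less than [eps] apart in the
    sup norm, so each cell holds at most one point. *)
Lemma size_packing s (eps rad : R) :
  uniq s -> 0 < eps -> 0 <= rad -> (forall t, t \in s -> `|f t| <= rad) ->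
  (forall t u, t \in s -> u \in s -> t != u -> eps <= `|f t - f u|) ->
  (size s)%:R <= (2 * (rad / eps) + 3) ^+ d.
Proof.
move=> us e0 r0 sr sep.
set q := rad / eps.
have q0 : 0 <= q by rewrite divr_ge0// ltW.
pose N := (2 * Num.truncn q).+3.
(* The shift by [q + 1] makes every coordinate nonnegative, so that [truncn] is the floor and the
   cell index stays below [N]. *)
pose g t : {ffun 'I_d -> 'I_N} :=
  [ffun i => inord (Num.truncn (f t ord0 i / eps + q + 1))].
have fq t i : t \in s -> `|f t ord0 i / eps| <= q.
  move=> ts; rewrite normrM normfV (gtr0_norm e0) ler_pM2r ?invr_gt0//.
  exact: le_trans (norm_coord_le _ _) (sr _ ts).
have fge0 t i : t \in s -> 0 <= f t ord0 i / eps + q + 1.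
  by move=> /(fq _ i); rewrite ler_norml => /andP[h _]; lra.
have trN t i : t \in s -> (Num.truncn (f t ord0 i / eps + q + 1) < N)%N.
  move=> ts; rewrite -(ltr_nat R).
  have := truncn_le_self (fge0 _ i ts); have := truncnS_gt q.
  have := fq _ i ts; rewrite ler_norml => /andP[_ h1].
  rewrite /N -addn3 natrD natrM -natr1; lra.
have ginj : {in s &, injective g}.
  move=> t u ts us' gtu; apply/eqP/negP => /negP tu.
  suff : `|f t - f u| < eps by rewrite ltNge (sep _ _ ts us' tu).
  apply: row_norm_lt => // i; rewrite !mxE.
  have /(congr1 (fun h : {ffun _ -> _} => nat_of_ord (h i))) := gtu.
  rewrite !ffunE !inordK ?trN// => E.
  have := truncn_le_self (fge0 _ i ts); have := truncn_le_self (fge0 _ i us').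
  have := truncnS_gt (f t ord0 i / eps + q + 1).
  have := truncnS_gt (f u ord0 i / eps + q + 1).
  rewrite E -natr1 => h1 h2 h3 h4.
  rewrite -(ltr_pM2r (_ : 0 < eps^-1)) ?invr_gt0// mulfV ?gt_eqF//.
  rewrite -[eps^-1]gtr0_norm ?invr_gt0// -normrM mulrBl ltr_norml; lra.
have : (size s <= #|{ffun 'I_d -> 'I_N}|)%N.
  rewrite -(size_map g) -(card_uniqP _); first exact: max_card.
  by rewrite map_inj_in_uniq.
rewrite card_ffun !card_ord -(ler_nat R) => /le_trans; apply.
rewrite natrX lerXn2r ?nnegrE//; first by lra.
by rewrite /N -addn3 natrD natrM; have := truncn_le_self q0; lra.
Qed.

Lemma finite_packing A (eps rad : R) :
  0 < eps -> 0 <= rad -> (forall t, A t -> `|f t| <= rad) ->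
  (forall t u, A t -> A u -> t <> u -> eps <= `|f t - f u|) ->
  finite_set A.
Proof.
move=> e0 r0 Ar sep; apply: contrapT => /infinite_set_fsetP.
pose b := (2 * (rad / eps) + 3) ^+ d.
move=> /(_ (Num.truncn b).+1)[B BA]; rewrite leqNgt => /negP; apply.
rewrite -(ltr_nat R); apply: le_lt_trans (truncnS_gt b).
apply: size_packing => // [t tB|t u tB uB /eqP tu]; first exact/Ar/BA.
by apply: sep => //; exact: BA.
Qed.

(** Two points of a grid of mesh [3 * D] cannot be [D]-close to the same centre, so there are at
    least as many centres as grid points in the ball. *)
Lemma size_covering s (D rad : R) :
  0 < D -> 0 <= rad ->
  (forall z, `|z| <= rad -> exists2 t, t \in s & `|z - f t| <= D) ->
  (rad / (3 * D)) ^+ d <= (size s)%:R.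
Proof.
move=> D0 r0 cov.
set q := rad / (3 * D).
have q0 : 0 <= q by rewrite divr_ge0//; lra.
pose M := (Num.truncn q).+1.
pose z (g : {ffun 'I_d -> 'I_M}) : 'rV[R]_d := \row_i (3 * D * (g i)%:R).
have zr g : `|z g| <= rad.
  apply: row_norm_le => // i; rewrite mxE ger0_norm; last first.
    by rewrite mulr_ge0//; lra.
  rewrite mulrC -ler_pdivlMr; last lra.
  apply: le_trans (truncn_le_self q0); rewrite ler_nat -ltnS; exact: ltn_ord.
have zsep g h : g != h -> 3 * D <= `|z g - z h|.
  move=> gh; have [i ghi] : exists i, g i != h i.
    by apply/existsP; apply: contraNT gh => /existsPn H; apply/eqP/ffunP => i;
       apply/eqP; have := H i; rewrite negbK.
  apply: le_trans (norm_coord_le _ i); rewrite !mxE -mulrBr normrM.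
  rewrite gtr0_norm; last lra.
  rewrite ler_peMr//; first lra.
  rewrite -[(g i)%:R]/((g i)%:Z%:~R) -[(h i)%:R]/((h i)%:Z%:~R).
  by rewrite -intrB -intr_norm ler1z; move: ghi; rewrite -val_eqE/=; lia.
pose c g := s2val (cid2 (cov _ (zr g))).
have cs g : c g \in s by rewrite /c; case: cid2.
have cD g : `|z g - f (c g)| <= D by rewrite /c; case: cid2.
have cinj : injective c.
  move=> g h gh; apply/eqP/negP => /negP /zsep.
  have := cD g; have := cD h; rewrite gh.
  have : `|z g - z h| <= `|z g - f (c h)| + `|z h - f (c h)|.
    rewrite [X in _ <= _ + X]distrC; apply: le_trans (ler_normD _ _).
    by rewrite addrA subrK.
  lra.
have : (#|{ffun 'I_d -> 'I_M}| <= size s)%N.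
  rewrite cardE -(size_map c); apply: uniq_leq_size.
    by rewrite map_inj_uniq// enum_uniq.
  by move=> _ /mapP[g _ ->].
rewrite card_ffun !card_ord -(ler_nat R); apply: le_trans.
rewrite natrX lerXn2r ?nnegrE//; exact/ltW/truncnS_gt.
Qed.

End Packing.

Section Powers.
Variable R : realType.
Implicit Types x y C M : R.

Lemma expr_unbounded x M : 1 < x -> exists n, M < x ^+ n.
Proof.
move=> x1; have H n : 1 + n%:R * (x - 1) <= x ^+ n.
  elim: n => [|n ih]; first by rewrite mul0r addr0 expr0.
  rewrite exprS -natr1; apply: (@le_trans _ _ (x * (1 + n%:R * (x - 1)))).
    have : 0 <= n%:R * (x - 1) ^+ 2 by rewrite mulr_ge0// sqr_ge0.
    nra.
  by rewrite ler_pM2l//; lra.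
exists (Num.truncn (`|M| / (x - 1))).+1; apply: lt_le_trans (H _).
have := truncnS_gt (`|M| / (x - 1)); rewrite ltr_pdivrMr; last lra.
by have := ler_norm M; lra.
Qed.

Lemma le_of_expr_le x y C : 0 < y ->
  (forall n, x ^+ n <= C * y ^+ n) -> x <= y.
Proof.
move=> y0 H; rewrite leNgt; apply/negP => yx.
have xy1 : 1 < x / y by rewrite ltr_pdivlMr// mul1r.
have [n] := expr_unbounded C xy1.
by rewrite expr_div_n ltr_pdivlMr ?exprn_gt0// ltNge H.
Qed.

End Powers.

(** * Supertiles *)

Section Supertiles.
Variables (R : realType) (d k : nat) (S : substitution R d k).
Local Notation tile := (tile R d k).
Local Notation lam := (expansion S).
Implicit Types (t u v : tile) (Q W : set tile).

Lemma expansion_gt0 : 0 < lam.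
Proof. exact: lt_trans (expansion_gt1 S). Qed.

Lemma expansionX_gt0 n : 0 < lam ^+ n.
Proof. exact/exprn_gt0/expansion_gt0. Qed.

Lemma expansionX_neq0 n : lam ^+ n != 0.
Proof. exact/lt0r_neq0/expansionX_gt0. Qed.

Lemma expansionX_ge1 n : 1 <= lam ^+ n.
Proof. exact/exprn_ege1/ltW/expansion_gt1. Qed.

Lemma supportE t z : support S t z <-> S t.1 (z - t.2).
Proof.
split=> [[y ty <-]|tz]; first by rewrite addrK.
by exists (z - t.2) => //; rewrite subrK.
Qed.

Definition shift_tile (x : 'rV[R]_d) t : tile := (t.1, t.2 + x).

Lemma shift_tileK x : cancel (shift_tile x) (shift_tile (- x)).
Proof. by case=> p y; rewrite /shift_tile/= addrK. Qed.

Lemma shift_tileNK x : cancel (shift_tile (- x)) (shift_tile x).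
Proof. by case=> p y; rewrite /shift_tile/= subrK. Qed.

Lemma shift_tileD x y t : shift_tile x (shift_tile y t) = shift_tile (y + x) t.
Proof. by rewrite /shift_tile/= addrA. Qed.

Lemma translateP x Q u : translate x Q u <-> Q (shift_tile (- x) u).
Proof.
split=> [[t Qt <-]|Qu]; first by rewrite -/(shift_tile x t) shift_tileK.
by exists (shift_tile (- x) u) => //; rewrite -/(shift_tile x _) shift_tileNK.
Qed.

Lemma support_shift x t z : support S (shift_tile x t) z <-> support S t (z - x).
Proof. by rewrite !supportE/= opprD addrA addrAC. Qed.

Lemma interior_shift x t z :
  interior (support S (shift_tile x t)) z <-> interior (support S t) (z - x).
Proof.
rewrite !interior_ballP; split=> -[e e0 H]; exists e => // y yz.
  have /H/support_shift : `|(y + x) - z| < e by move: yz; rewrite opprB addrA.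
  by rewrite addrK.
by apply/support_shift/H; rewrite opprB addrA subrK.
Qed.

Definition tile_subst t : seq tile :=
  [seq shift_tile (lam *: t.2) u | u <- omega S t.1].

(** A list version of the iterated substitution, started from a tile in any position, so that tiles
    can be counted and summed over; [uniq_supertile] excludes repetitions. *)
Fixpoint supertile n t : seq tile :=
  if n is m.+1 then flatten [seq tile_subst u | u <- supertile m t] else [:: t].

Lemma mem_tile_subst t u :
  (u \in tile_subst t) = (shift_tile (- (lam *: t.2)) u \in omega S t.1).
Proof.
rewrite /tile_subst -{1}[u](shift_tileNK (lam *: t.2)) mem_map//.
exact: can_inj (shift_tileK (lam *: t.2)).
Qed.

Lemma supertileSP n t u :
  reflect (exists2 v, v \in supertile n t & u \in tile_subst v)
          (u \in supertile n.+1 t).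
Proof. exact: flatten_mapP. Qed.

Lemma supertileDP m n t u :
  u \in supertile (m + n) t <->
  exists2 v, v \in supertile n t & u \in supertile m v.
Proof.
elim: m u => [|m ih] u.
  rewrite add0n; split=> [ut|[v vt]]; first by exists u => //; rewrite inE.
  by rewrite inE => /eqP->.
rewrite addSn; split.
  move=> /supertileSP[w /ih[v vt wv] uw]; exists v => //.
  by apply/supertileSP; exists w.
move=> [v vt /supertileSP[w wv uw]]; apply/supertileSP; exists w => //.
by apply/ih; exists v.
Qed.

Lemma supertile_shift n x t u :
  (shift_tile (lam ^+ n *: x) u \in supertile n (shift_tile x t)) = (u \in supertile n t).
Proof.
have H y (s : tile) w : w \in supertile n s ->
    shift_tile (lam ^+ n *: y) w \in supertile n (shift_tile y s).
  elim: n w => [|n ih] w; first by rewrite !inE => /eqP->; rewrite expr0 scale1r.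
  move=> /supertileSP[v vt wv]; apply/supertileSP.
  exists (shift_tile (lam ^+ n *: y) v); first exact: ih.
  move: wv; rewrite !mem_tile_subst /= shift_tileD.
  by rewrite scalerDr scalerA -exprS opprD [- _ - _]addrC addrA subrr sub0r.
apply/idP/idP => [/(H (- x))|/H//].
by rewrite shift_tileK scalerN shift_tileK.
Qed.

Lemma omega_iterE n p : omega_iter S n p = [set` supertile n (p, 0)].
Proof.
elim: n => [|n ih].
  by apply/seteqP; split=> u /=; rewrite inE => /eqP.
apply/seteqP; split=> u /=.
  move=> [t /= tn tu]; apply/supertileSP; exists t.
    by move: tn; rewrite -/(omega_iter S n p) ih.
  by rewrite mem_tile_subst; move/translateP: tu.
move=> /supertileSP[t tn ut]; exists t; first by rewrite -/(omega_iter S n p) ih.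
by apply/translateP; rewrite -/(is_true _) /=; move: ut; rewrite mem_tile_subst.
Qed.

(** Each substitution multiplies the covered region by [lam]; the inflation is read backwards, as a
    contraction of the point. *)
Lemma supertile_support n t z :
  (exists2 u, u \in supertile n t & support S u z) <->
  support S t ((lam ^+ n)^-1 *: z).
Proof.
elim: n z => [|n ih] z.
  rewrite expr0 invr1 scale1r; split=> [[u]|tz]; first by rewrite inE => /eqP->.
  by exists t => //; rewrite inE.
have lam0 : lam != 0 by exact/lt0r_neq0/expansion_gt0.
have key v w : (exists2 u, u \in tile_subst v & support S u w) <->
    support S v (lam^-1 *: w).
  have /seteqP[H1 H2] := omega_support S v.1.
  rewrite supportE; split.
    move=> [u uv uw].
    have /H1[y Sy yE] : supports S [set` omega S v.1] (w - lam *: v.2).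
      exists (shift_tile (- (lam *: v.2)) u); first by rewrite /= -mem_tile_subst.
      by apply/support_shift; rewrite opprK subrK.
    suff -> : lam^-1 *: w - v.2 = y by [].
    apply: (scalerI lam0); rewrite yE scalerBr scalerA mulfV// scale1r//.
  move=> Sw; have /H2[u uv uw] :
      [set lam *: y | y in S v.1] (w - lam *: v.2).
    exists (lam^-1 *: w - v.2) => //.
    by rewrite scalerBr scalerA mulfV// scale1r.
  exists (shift_tile (lam *: v.2) u); first by rewrite mem_tile_subst shift_tileK.
  exact/support_shift.
split.
  move=> [u /supertileSP[v vt uv] uz].
  have /key vz : exists2 u, u \in tile_subst v & support S u z by exists u.
  rewrite exprSr invfM -scalerA; apply/ih; by exists v.
rewrite exprSr invfM -scalerA => /ih[v vt /key[u uv uz]].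
by exists u => //; apply/supertileSP; exists v.
Qed.

Lemma supertile_interior n t u z : u \in supertile n t ->
  interior (support S u) z -> interior (support S t) ((lam ^+ n)^-1 *: z).
Proof.
move=> ut /interior_ballP[e e0 He]; apply/interior_ballP.
exists (e / lam ^+ n); first by rewrite divr_gt0// expansionX_gt0.
move=> y yz; rewrite -[y](scalerK (expansionX_neq0 n)).
apply/supertile_support; exists u => //; apply: He.
have := expansionX_gt0 n => ln0.
rewrite -(scalerKV (expansionX_neq0 n) z) -scalerBr normrZ gtr0_norm//.
by rewrite mulrC -ltr_pdivlMr.
Qed.

Definition disjoint_tiles t u :=
  interior (support S t) `&` interior (support S u) = set0.

Lemma tile_subst_disjoint t u v : u \in tile_subst t -> v \in tile_subst t ->
  u <> v -> disjoint_tiles u v.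
Proof.
rewrite !mem_tile_subst => ut vt uv; apply/seteqP; split=> // z [zu zv].
have: ([set` omega S t.1] (shift_tile (- (lam *: t.2)) u)) by [].
move/(@omega_patch _ _ _ S t.1); move/(_ _ vt).
have H : shift_tile (- (lam *: t.2)) u <> shift_tile (- (lam *: t.2)) v.
  by move=> /(can_inj (@shift_tileNK _)).
move=> /(_ H)/seteqP[/(_ (z - lam *: t.2)) H' _]; apply: H'.
by split; apply/interior_shift; rewrite opprK subrK.
Qed.

Lemma supertile_disjoint n t t' u v : disjoint_tiles t t' ->
  u \in supertile n t -> v \in supertile n t' -> disjoint_tiles u v.
Proof.
move=> /seteqP[tt' _] ut vt'; apply/seteqP; split=> // z [zu zv].
by apply: (tt' ((lam ^+ n)^-1 *: z)); split;
   [exact: supertile_interior zu|exact: supertile_interior zv].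
Qed.

Lemma supertile_patch n t : is_patch S [set` supertile n t].
Proof.
elim: n t => [|n ih] t u v /=.
  by rewrite !inE => /eqP-> /eqP->.
move=> /supertileSP[u' u't uu'] /supertileSP[v' v't vv'] uv.
have [E|/eqP u'v'] := eqVneq u' v'.
  by apply: tile_subst_disjoint uu' _ uv; rewrite E.
apply: (@supertile_disjoint 1 u' v'); first exact: ih u't v't u'v'.
- by rewrite /= cats0.
- by rewrite /= cats0.
Qed.

Lemma interior_puncture t : interior (support S t) t.2.
Proof.
rewrite -[t.2]add0r.
have /interior_ballP[e e0 H] := shape_origin (protos S) t.1.
apply/interior_ballP; exists e => // y; rewrite add0r => yt.
by apply/supportE/H; rewrite subr0.
Qed.

Lemma disjoint_tiles_neq t u : disjoint_tiles t u -> t <> u.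
Proof.
move=> /seteqP[H _] E; apply: (H t.2); split; first exact: interior_puncture.
by rewrite -E; exact: interior_puncture.
Qed.

(** Tiles with different parents have disjoint interiors, and a puncture is interior to its tile, so
    such tiles are distinct. *)
Lemma uniq_supertile n t : uniq (supertile n t).
Proof.
elim: n => //= n ih.
have -> : flatten [seq tile_subst u | u <- supertile n t] =
    [seq v | u <- supertile n t, v <- tile_subst u].
  by congr flatten; apply: eq_map => u; rewrite map_id.
apply: allpairs_uniq_dep => //.
  move=> u _; rewrite map_inj_uniq ?fset_uniq//.
  exact: can_inj (shift_tileK (lam *: u.2)).
move=> [u v] [u' v'] /= /allpairsPdep[x [y [xn yx]]] E.
move=> /allpairsPdep[x' [y' [x'n y'x']]] E' vv'.
case: E => ? ?; case: E' => ? ?; subst.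
have [E|/eqP uu'] := eqVneq x x'; first by subst.
have := supertile_patch xn x'n uu'.
move=> dis; have := @supertile_disjoint 1 _ _ y' y' dis.
by rewrite /= !cats0 => /(_ yx y'x')/disjoint_tiles_neq.
Qed.

Lemma exists_inner_radius :
  exists2 eta, 0 < eta & forall p y, `|y| < eta -> S p y.
Proof.
have H p : exists e, 0 < e /\ forall y, `|y| < e -> S p y.
  have /interior_ballP[e e0 He] := shape_origin (protos S) p.
  by exists e; split=> // y ye; apply: He; rewrite subr0.
have [e He] := choice H.
exists (\big[Num.min/1]_p e p).
  by apply: lt_bigmin => // p _; case: (He p).
move=> p y yp; have [_] := He p; apply.
by apply: lt_le_trans yp _; exact: bigmin_le_cond.
Qed.

Lemma exists_outer_radius :
  exists2 D, 0 < D & forall p y, S p y -> `|y| <= D.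
Proof.
have H p : exists M, 0 < M /\ forall y, S p y -> `|y| <= M.
  have [M [_ HM]] := compact_bounded (@shape_compact _ _ _ S p).
  exists (`|M| + 1); split; first by rewrite ltr_wpDl.
  by move=> y Sy; apply: HM => //; rewrite (le_lt_trans (ler_norm _))// ltrDl.
have [M HM] := choice H.
exists (1 + \sum_p M p).
  by rewrite ltr_wpDr// sumr_ge0// => p _; case: (HM p) => /ltW.
move=> p y /(proj2 (HM p))/le_trans; apply.
rewrite (bigD1 p)//= addrCA lerDl addr_ge0// sumr_ge0// => q _.
by case: (HM q) => /ltW.
Qed.

(** Sup-norm radii common to the finitely many prototiles: about its puncture, every tile contains
    the open ball of radius [eta] and lies in the closed ball of radius [D]. *)
Definition inner_radius := s2val (cid2 exists_inner_radius).
Definition outer_radius := s2val (cid2 exists_outer_radius).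
Local Notation eta := inner_radius.
Local Notation D := outer_radius.

Lemma inner_radius_gt0 : 0 < eta.
Proof. exact: s2valP (cid2 exists_inner_radius). Qed.

Lemma outer_radius_gt0 : 0 < D.
Proof. exact: s2valP (cid2 exists_outer_radius). Qed.

Lemma support_inner t z : `|z - t.2| < eta -> support S t z.
Proof. by move=> H; apply/supportE; exact: (s2valP' (cid2 exists_inner_radius)). Qed.

Lemma support_outer t z : support S t z -> `|z - t.2| <= D.
Proof. by move=> /supportE; exact: (s2valP' (cid2 exists_outer_radius)). Qed.

Lemma interior_inner t z : `|z - t.2| < eta -> interior (support S t) z.
Proof.
move=> zt; apply/interior_ballP; exists (eta - `|z - t.2|); first by rewrite subr_gt0.
move=> y yz; apply: support_inner.
have -> : y - t.2 = (y - z) + (z - t.2) by rewrite addrA subrK.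
by rewrite (le_lt_trans (ler_normD _ _))// -ltrBrDr.
Qed.

Lemma puncture_sep t u : disjoint_tiles t u -> eta <= `|t.2 - u.2|.
Proof.
move=> /seteqP[tu _]; rewrite leNgt; apply/negP => H; apply: (tu t.2).
by split; [exact: interior_puncture|exact: interior_inner].
Qed.

Lemma closed_support t : closed (support S t).
Proof.
apply: compact_closed; first exact: norm_hausdorff.
refine (@continuous_compact 'rV[R]_d 'rV[R]_d (fun y => y + t.2) (S t.1) _ _).
  apply: continuous_subspaceT => y.
  move=> U /nbhs_ballP[e e0 yU]; apply/nbhs_ballP; exists e => // z yz.
  by apply: yU; move: yz; rewrite -!ball_normE/= opprD addrACA subrr addr0.
exact: shape_compact.
Qed.

(* A prototile is not known to be the closure of its interior, so a tile of [P]
   that meets the interior of [u] need not share an interior point with [u]; a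
   tile that does is found by Baire's theorem. *)
Lemma patch_cover_mem W (P : seq tile) (O : set 'rV[R]_d) u z :
  is_patch S W -> (forall v, v \in P -> W v) -> W u ->
  open O -> (forall x, O x -> exists2 v, v \in P & support S v x) ->
  O z -> interior (support S u) z -> u \in P.
Proof.
move=> Wp PW Wu Oop Ocov Oz uz.
have [|||v [y [vP [Oy uy] vy]]] := @finite_closed_cover_interior R d _ P
    (support S) (O `&` interior (support S u)) closed_support.
- by apply: openI => //; exact: open_interior.
- by exists z.
- by move=> x [/Ocov].
have [->//|/eqP uv] := eqVneq u v.
by have /seteqP[/(_ y) H _] := Wp _ _ Wu (PW _ vP) uv; have := H (conj uy vy).
Qed.

End Supertiles.

(** * Legal patches and growth *)

Section Legal.
Variables (R : realType) (d k : nat) (S : substitution R d k).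
Local Notation tile := (tile R d k).
Local Notation lam := (expansion S).
Local Notation eta := (inner_radius S).
Local Notation D := (outer_radius S).
Local Notation A := (subst_matrix S).
Implicit Types (t u v : tile) (Q W : set tile).

Lemma supertile_origin n t u :
  (u \in supertile S n t) =
  (shift_tile (- (lam ^+ n *: t.2)) u \in supertile S n (t.1, 0)).
Proof.
rewrite -(supertile_shift S n (- t.2) t u) scalerN.
by rewrite /shift_tile/= subrr.
Qed.

Lemma supertile_neq0 n t : exists u, u \in supertile S n t.
Proof.
have [_ /(_ _)[|u ut _]] := supertile_support S n t (lam ^+ n *: t.2).
  rewrite scalerK ?expansionX_neq0//.
  by apply: support_inner; rewrite subrr normr0 inner_radius_gt0.
by exists u.
Qed.

Lemma puncture_supertile n t u : u \in supertile S n t ->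
  `|u.2 - lam ^+ n *: t.2| <= D * lam ^+ n.
Proof.
move=> ut; have : support S t ((lam ^+ n)^-1 *: u.2).
  apply/supertile_support; exists u => //.
  by apply: support_inner; rewrite subrr normr0 inner_radius_gt0.
have l0 := expansionX_gt0 S n.
move/support_outer; rewrite -(ler_pM2r l0); apply: le_trans.
rewrite mulrC -{2}(gtr0_norm l0) -normrZ scalerBr scalerKV//.
exact: expansionX_neq0.
Qed.

(** Packing: the punctures are [eta]-separated and within [D * lam ^+ n] of the centre. The additive
    3 is absorbed since [lam ^+ n >= 1]. *)
Lemma size_supertile_le : exists2 C, 0 < C &
  forall n t, (size (supertile S n t))%:R <= (C * lam ^+ n) ^+ d.
Proof.
have [e0 D0] := (inner_radius_gt0 S, outer_radius_gt0 S).
exists (2 * (D / eta) + 3) => [|n t].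
  by rewrite addr_gt0// mulr_gt0// divr_gt0.
have l1 := expansionX_ge1 S n.
have De0 : 0 < D / eta by rewrite divr_gt0.
apply: (@le_trans _ _ ((2 * (D * lam ^+ n / eta) + 3) ^+ d)).
  apply: (@size_packing _ _ _ (fun u : tile => u.2 - lam ^+ n *: t.2)) => //.
  - exact: uniq_supertile.
  - by rewrite mulr_ge0//; lra.
  - by move=> u; exact: puncture_supertile.
  - move=> u v ut vt /eqP uv; rewrite opprB addrA subrK.
    exact/puncture_sep/(supertile_patch ut vt uv).
rewrite lerXn2r ?nnegrE//; first 2 last.
- by rewrite mulrAC; nra.
- by rewrite addr_ge0// mulr_ge0// divr_ge0// ?mulr_ge0//; lra.
- by rewrite mulr_ge0//; lra.
Qed.

(** Covering: the supertile fills the ball of radius [eta / 2 * lam ^+ n] about its centre, and each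
    point of it is [D]-close to a puncture. The factor 1/2 turns a closed ball into a subset of the
    open inner one. *)
Lemma size_supertile_ge : exists2 c, 0 < c &
  forall n t, (c * lam ^+ n) ^+ d <= (size (supertile S n t))%:R.
Proof.
have [e0 D0] := (inner_radius_gt0 S, outer_radius_gt0 S).
exists (eta / 2 / (3 * D)) => [|n t]; first by rewrite !divr_gt0// mulr_gt0.
have l0 := expansionX_gt0 S n.
rewrite mulrAC.
apply: (@size_covering _ _ _ (fun u : tile => u.2 - lam ^+ n *: t.2)) => //.
  by rewrite mulr_ge0//; lra.
move=> z zle; have : support S t ((lam ^+ n)^-1 *: (z + lam ^+ n *: t.2)).
  apply: support_inner; rewrite scalerDr scalerK ?expansionX_neq0// addrK.
  rewrite normrZ gtr0_norm ?invr_gt0// mulrC ltr_pdivrMr//; nra.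
move=> /supertile_support[u ut /support_outer uz]; exists u => //.
by rewrite opprB addrA.
Qed.

Lemma subst_matrixE p q : A p q = count (fun u => u.1 == p) (omega S q).
Proof.
rewrite mxE -size_filter; apply/perm_size/uniq_perm.
- exact: fset_uniq.
- exact/filter_uniq/fset_uniq.
- by move=> u; rewrite !inE mem_filter/= andbC.
Qed.

Lemma sum_tile_subst (V : nmodType) (g : 'I_k -> V) t :
  \sum_(u <- tile_subst S t) g u.1 = \sum_p g p *+ A p t.1.
Proof.
rewrite big_map/= (eq_bigr (fun u => \sum_(p | u.1 == p) g p)); last first.
  by move=> u _; rewrite (big_pred1 u.1)// => p; rewrite eq_sym.
rewrite (exchange_big_dep predT)//=; apply: eq_bigr => p _.
by rewrite subst_matrixE big_const_seq iter_addr_0.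
Qed.

Lemma sum_supertileS (V : nmodType) (g : 'I_k -> V) n t :
  \sum_(u <- supertile S n.+1 t) g u.1 =
  \sum_(v <- supertile S n t) \sum_p g p *+ A p v.1.
Proof.
rewrite /= big_flatten/= big_map; apply: eq_bigr => v _.
exact: sum_tile_subst.
Qed.

(** For [g] the indicator of one type this says that powers of [A] count the tiles of that type in a
    supertile. *)
Lemma sum_supertile (g : 'I_k -> nat) n t :
  \sum_(u <- supertile S n t) g u.1 = \sum_p g p * (A ^+ n) p t.1.
Proof.
elim: n g => [|n ih] g.
  rewrite expr0 /= big_seq1 (bigD1 t.1)//= mxE eqxx mulr1 big1 ?addr0//.
  by move=> p /negPf pt; rewrite mxE pt mulr0.
rewrite sum_supertileS (ih (fun q => \sum_p g p *+ A p q)).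
under eq_bigr => q _ do rewrite mulr_suml.
rewrite exchange_big/=; apply: eq_bigr => p _.
rewrite exprS mxE mulr_sumr; apply: eq_bigr => q _.
by rewrite mulrnAl -mulrnAr; congr (_ * _); rewrite -mulr_natl natn.
Qed.

Lemma supertile_has_type n t p :
  (0 < (A ^+ n) p t.1)%N -> exists2 u, u \in supertile S n t & u.1 = p.
Proof.
have := sum_supertile (fun q => (q == p) : nat) n t.
rewrite [RHS](bigD1 p)//= eqxx mul1r [X in _ + X]big1 ?addr0; last first.
  by move=> q /negPf->; rewrite mul0r.
move=> <- H; apply: contrapT => no.
move: H; rewrite big_seq big1// => u ut; case: eqP => // up.
by case: no; exists u.
Qed.

(** The translation in the definition of the tiling space is absorbed here into the position of [t],
    which can be moved by any amount divided by [lam ^+ n]. *)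
Definition legal Q := exists n t, forall u, Q u -> u \in supertile S n t.

Lemma legalP Q : legal Q <-> exists x n p, translate x Q `<=` omega_iter S n p.
Proof.
split=> [[n [t Qt]]|[x [n [p Qp]]]].
  exists (- (lam ^+ n *: t.2)), n, t.1 => u /translateP; rewrite opprK => /Qt.
  by rewrite supertile_origin omega_iterE/= shift_tileK.
exists n, (p, - ((lam ^+ n)^-1 *: x)) => u Qu.
rewrite supertile_origin /= scalerN opprK scalerKV ?expansionX_neq0//.
have /Qp : translate x Q (shift_tile x u) by apply/translateP; rewrite shift_tileK.
by rewrite omega_iterE.
Qed.

Lemma legal_sub Q Q' : Q `<=` Q' -> legal Q' -> legal Q.
Proof. by move=> QQ' [n [t H]]; exists n, t => u /QQ'/H. Qed.

Lemma legal_translate x Q : legal Q -> legal (translate x Q).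
Proof.
move=> [n [t Qt]]; exists n, (shift_tile ((lam ^+ n)^-1 *: x) t) => u /translateP/Qt.
rewrite -(supertile_shift S n ((lam ^+ n)^-1 *: x)).
by rewrite scalerKV ?expansionX_neq0// shift_tileNK.
Qed.

Lemma legal_translate_iff x Q : legal (translate x Q) <-> legal Q.
Proof.
split; last exact: legal_translate.
move/(legal_translate (- x)); apply: legal_sub => u Qu.
by apply/translateP/translateP; rewrite opprK shift_tileK.
Qed.

Lemma finite_legal Q : legal Q -> finite_set Q.
Proof.
move=> [n [t Qt]]; apply: (@sub_finite_set _ _ [set` supertile S n t]).
  by move=> u /Qt.
exact: finite_seq.
Qed.

Hypothesis Sprim : primitive_subst S.

Lemma exists_primitive_level : exists m0, forall m t p, (m0 <= m)%N ->
  exists2 u, u \in supertile S m t & u.1 = p.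
Proof.
have [m0 _ H] := Sprim; exists m0 => m t p m0m.
have [v vt] := supertile_neq0 (m - m0) t.
have [u uv up] := supertile_has_type (H p v.1).
by exists u => //; rewrite -(subnKC m0m); apply/supertileDP; exists v.
Qed.

(** By primitivity the level-[m] supertile of type [q] contains a tile of the type of [t]; moving
    the parent by [lam ^- m] times the offset puts that tile onto [t]. *)
Lemma exists_ancestor : exists m0, forall m t q, (m0 <= m)%N ->
  exists2 s, s.1 = q & t \in supertile S m s.
Proof.
have [m0 H] := exists_primitive_level; exists m0 => m t q /H.
move=> /(_ (q, 0) t.1)[u uq ut].
pose z := (lam ^+ m)^-1 *: (t.2 - u.2).
exists (shift_tile z (q, 0)) => //.
suff -> : t = shift_tile (lam ^+ m *: z) u by rewrite supertile_shift.
by rewrite scalerKV ?expansionX_neq0// /shift_tile ut addrC subrK; case: (t).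
Qed.

Lemma legal_deep Q n0 : legal Q ->
  exists n t, (n0 <= n)%N /\ forall u, Q u -> u \in supertile S n t.
Proof.
move=> [n [t Qt]]; have [m0 H] := exists_ancestor.
have [s _ ts] := H (maxn m0 n0) t t.1 (leq_maxl _ _).
exists (n + maxn m0 n0)%N, s; split.
  by rewrite (leq_trans (leq_maxr m0 n0))// leq_addl.
by move=> u /Qt ut; apply/supertileDP; exists t.
Qed.

End Legal.

Section Growth.
Variables (R : realType) (d k : nat) (S : substitution R d k).
Variables (Lambda : R) (nu : 'cV[R]_k).
Hypothesis PF : perron_data (subst_matrix S) Lambda nu.
Local Notation A := (subst_matrix S).
Local Notation lam := (expansion S).

Lemma perron_eigenvector p :
  \sum_q nu q ord0 *+ A p q = Lambda * nu p ord0.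
Proof.
case: PF => _ /matrixP/(_ p ord0) H _ _; move: H; rewrite !mxE => <-.
by apply: eq_bigr => q _; rewrite !mxE mulr_natl.
Qed.

(** Weighting the root type by the eigenvector makes tile counts exactly geometric: for [g = 1] the
    mean size of a level-[n] supertile is [Lambda ^+ n]. *)
Lemma perron_sum_supertile (g : 'I_k -> R) n :
  \sum_q nu q ord0 * \sum_(u <- supertile S n (q, 0)) g u.1 =
  Lambda ^+ n * \sum_q g q * nu q ord0.
Proof.
elim: n g => [|n ih] g.
  by rewrite expr0 mul1r; apply: eq_bigr => q _; rewrite big_seq1 mulrC.
under eq_bigr => q _ do rewrite sum_supertileS.
rewrite (ih (fun q => \sum_p g p *+ A p q)) exprSr -mulrA; congr (_ * _).
under eq_bigr => q _ do rewrite mulr_suml.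
rewrite exchange_big/= mulr_sumr; apply: eq_bigr => p _.
rewrite mulrCA -perron_eigenvector mulr_sumr; apply: eq_bigr => q _.
by rewrite mulrnAl mulrnAr.
Qed.

Lemma perron_gt0 p : 0 < nu p ord0.
Proof. by case: PF. Qed.

Lemma perron_sum1 : \sum_p nu p ord0 = 1.
Proof. by case: PF. Qed.

(** [Lambda ^+ n] is a weighted mean of supertile sizes, hence lies between two constant multiples
    of [(lam ^+ d) ^+ n] for every [n]; this forces equal growth rates. *)
Lemma perron_eigenvalueE : Lambda = lam ^+ d.
Proof.
have key n : Lambda ^+ n =
    \sum_q nu q ord0 * (size (supertile S n (q, 0)))%:R.
  have := perron_sum_supertile (fun=> 1) n.
  under [X in _ = _ * X]eq_bigr do rewrite mul1r.
  rewrite perron_sum1 mulr1 => <-; apply: eq_bigr => q _.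
  by rewrite big_const_seq count_predT iter_addr_0.
have [C C0 HC] := size_supertile_le S.
have [c c0 Hc] := size_supertile_ge S.
have ld0 : 0 < lam ^+ d by exact: expansionX_gt0.
have up n : Lambda ^+ n <= C ^+ d * (lam ^+ d) ^+ n.
  rewrite key; apply: (@le_trans _ _
    (\sum_q nu q ord0 * (C ^+ d * (lam ^+ d) ^+ n))); last first.
    by rewrite -mulr_suml perron_sum1 mul1r.
  apply: ler_sum => q _.
  rewrite ler_pM2l ?perron_gt0//.
  by rewrite -exprM mulnC exprM -exprMn.
have lo n : c ^+ d * (lam ^+ d) ^+ n <= Lambda ^+ n.
  rewrite key; apply: (@le_trans _ _
    (\sum_q nu q ord0 * (c ^+ d * (lam ^+ d) ^+ n))).
    by rewrite -mulr_suml perron_sum1 mul1r.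
  apply: ler_sum => q _.
  rewrite ler_pM2l ?perron_gt0//.
  by rewrite -exprM mulnC exprM -exprMn.
have L0 : 0 < Lambda.
  by have := lo 1%N; rewrite !expr1; apply: lt_le_trans; rewrite mulr_gt0// exprn_gt0.
apply/eqP; rewrite eq_le; apply/andP; split; first exact: le_of_expr_le up.
apply: (@le_of_expr_le _ _ _ (c ^+ d)^-1) => // n.
by rewrite mulrC ler_pdivlMr ?exprn_gt0// mulrC.
Qed.

Lemma perron_size_gt0 : (0 < k)%N.
Proof.
case: k nu perron_sum1 => // nu0; rewrite big_ord0 => /esym/eqP.
by rewrite oner_eq0.
Qed.

End Growth.

(** * A self-similar tiling and patch complexity *)

Section SelfSimilar.
Variables (R : realType) (d k : nat) (S : substitution R d k).
Local Notation tile := (tile R d k).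
Local Notation lam := (expansion S).
Local Notation eta := (inner_radius S).
Local Notation D := (outer_radius S).
Implicit Types (t u v : tile) (Q W : set tile).
Hypotheses (k_gt0 : (0 < k)%N) (Sprim : primitive_subst S).

(** The second condition makes the supertiles of [t] of levels [j * N] nested; the third makes them
    exhaust the space. *)
Definition self_similar_seed N t :=
  [/\ (0 < N)%N, t \in supertile S N t & interior (support S t) 0].

(** A tile [u] deep inside a large supertile has, by primitivity, an ancestor [s] of its own type.
    Translating so that the inflated copy of [u] becomes [s] itself gives a tile that occurs in its
    own supertile, well inside it. *)
Lemma exists_self_similar_seed : exists N t, self_similar_seed N t.
Proof.
have [e0 D0] := (inner_radius_gt0 S, outer_radius_gt0 S).
pose q : 'I_k := Ordinal k_gt0.
have [n nD] := expr_unbounded (2 * D / eta) (expansion_gt1 S).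
have [_ /(_ _)[|u uq u0]] := supertile_support S n (q, 0) 0.
  by rewrite scaler0; apply: support_inner; rewrite subrr normr0.
have [m0 Hm0] := exists_ancestor Sprim.
pose m := maxn m0 1.
have [s su qs] := Hm0 m (q, 0) u.1 (leq_maxl _ _).
pose N := (n + m)%N.
have N0 : (0 < N)%N by rewrite /N /m; lia.
have us : u \in supertile S N s by apply/supertileDP; exists (q, 0).
have ln0 := expansionX_gt0 S n.
(* By the choice of [n], the contraction of [u] by [lam ^+ n] falls into the inner ball of [(q, 0)],
   whose own contraction lies inside [s]. *)
have key y : support S u y -> interior (support S s) ((lam ^+ N)^-1 *: y).
  move=> uy; rewrite exprD invfM mulrC -scalerA.
  apply: supertile_interior qs _; apply: interior_inner; rewrite subr0.
  have : `|y| <= 2 * D.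
    have -> : y = (y - u.2) + u.2 by rewrite subrK.
    have := ler_normD (y - u.2) u.2; have := support_outer uy.
    have := support_outer u0; rewrite sub0r normrN; lra.
  move=> yD; rewrite normrZ gtr0_norm ?invr_gt0// mulrC ltr_pdivrMr//.
  by move: nD; rewrite ltr_pdivrMr// (mulrC eta); lra.
have lN1 : 1 < lam ^+ N.
  by rewrite exprn_egt1 ?expansion_gt1// ?lt0n_neq0.
have lN10 : lam ^+ N - 1 != 0 by rewrite subr_eq0 gt_eqF.
(* The solution of the fixed-point equation [u.2 + lam ^+ N *: x = s.2 + x]. *)
pose x := (lam ^+ N - 1)^-1 *: (s.2 - u.2).
have xE : u.2 + lam ^+ N *: x = s.2 + x.
  have : lam ^+ N *: x - x = s.2 - u.2.
    by rewrite -[X in _ - X]scale1r -scalerBl scalerKV.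
  by move/eqP; rewrite subr_eq => /eqP->; rewrite addrA subrKC.
pose t := shift_tile x s.
have tE : shift_tile (lam ^+ N *: x) u = t by rewrite /t /shift_tile su xE.
have tN : t \in supertile S N t by rewrite -{1}tE supertile_shift.
have keyt y : support S t y -> interior (support S t) ((lam ^+ N)^-1 *: y).
  rewrite -{1}tE => /support_shift/key; rewrite scalerBr scalerK ?expansionX_neq0//.
  by move=> H; apply/interior_shift.
exists N, t; split=> //.
suff t0 : support S t 0 by rewrite -(scaler0 _ (lam ^+ N)^-1); exact: keyt.
(* The contraction by [lam ^+ N] maps the tile into itself, so the orbit of the puncture stays in
   the closed support while tending to [0]. *)
have it j : support S t ((lam ^+ N)^-1 ^+ j *: t.2).
  elim: j => [|j ih].
    by rewrite expr0 scale1r; apply: support_inner; rewrite subrr normr0.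
  by rewrite exprS -scalerA; apply: interior_subset; exact: keyt.
apply: contrapT => t0.
have /interior_ballP[e e_gt0 He] : interior (~` support S t) 0.
  have op : open (~` support S t).
    exact/closed_openC/(@closed_support _ _ _ S t).
  by move: op; rewrite openE; apply.
have [j Hj] := expr_unbounded (`|t.2| / e) lN1.
apply: (He ((lam ^+ N)^-1 ^+ j *: t.2)); last exact: it.
have lj0 : 0 < (lam ^+ N) ^+ j by rewrite exprn_gt0 ?expansionX_gt0.
rewrite subr0 normrZ exprVn gtr0_norm ?invr_gt0//.
by rewrite ltr_pdivrMl// mulrC -ltr_pdivrMl// mulrC.
Qed.

Section Seed.
Variables (N : nat) (t0 : tile).
Hypothesis seed : self_similar_seed N t0.

Definition seed_tiling : set tile := [set u | exists j, u \in supertile S (j * N) t0].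

Lemma seed_mono i j u : (i <= j)%N ->
  u \in supertile S (i * N) t0 -> u \in supertile S (j * N) t0.
Proof.
have [_ t0N _] := seed.
have t0i m : t0 \in supertile S (m * N) t0.
  elim: m => [|m ih]; first by rewrite inE.
  by rewrite mulSn; apply/supertileDP; exists t0.
move=> ij ui; rewrite -(subnKC ij) mulnDl; apply/supertileDP.
by exists t0.
Qed.

Lemma seed_tiling_seq (s : seq tile) : (forall u, u \in s -> seed_tiling u) ->
  exists j, forall u, u \in s -> u \in supertile S (j * N) t0.
Proof.
elim: s => [|v s ih] H; first by exists 0%N.
have [i Hi] : seed_tiling v by apply: H; rewrite inE eqxx.
have [|j Hj] := ih; first by move=> u us; apply: H; rewrite inE us orbT.
exists (maxn i j) => u; rewrite inE => /orP[/eqP->|/Hj].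
  exact: seed_mono (leq_maxl _ _) Hi.
exact/seed_mono/leq_maxr.
Qed.

Lemma seed_tiling_patch : is_patch S seed_tiling.
Proof.
move=> u v Tu Tv; have [|j Hj] := @seed_tiling_seq [:: u; v].
  by move=> w; rewrite !inE => /orP[] /eqP->.
by apply: supertile_patch; apply: Hj; rewrite !inE eqxx ?orbT.
Qed.

Lemma seed_tiling_cover z : exists2 u, seed_tiling u & support S u z.
Proof.
have [N0 _ /interior_ballP[e e0 He]] := seed.
have lN1 : 1 < lam ^+ N by rewrite exprn_egt1 ?expansion_gt1// -lt0n.
have [j Hj] := expr_unbounded (`|z| / e) lN1.
have [_ /(_ _)[|u ut uz]] := supertile_support S (j * N) t0 z; last first.
  by exists u => //; exists j.
apply: He; rewrite subr0 normrZ gtr0_norm ?invr_gt0 ?expansionX_gt0//.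
rewrite mulrC ltr_pdivrMr ?expansionX_gt0// mulrC -ltr_pdivrMr//.
by rewrite mulnC exprM.
Qed.

Lemma seed_tiling_legal Q : finite_set Q -> Q `<=` seed_tiling -> legal S Q.
Proof.
move=> /finite_seqP[s ->] sT; have [j Hj] := seed_tiling_seq sT.
by exists (j * N)%N, t0.
Qed.

Lemma tiling_space_seed : tiling_space S seed_tiling.
Proof.
split; first split.
- exact: seed_tiling_patch.
- apply/seteqP; split=> // z _; exact: seed_tiling_cover.
- by move=> Q fQ QT; apply/legalP; exact: seed_tiling_legal.
Qed.

Lemma seed_tiling_supertile j v u :
  seed_tiling v -> u \in supertile S (j * N) v -> seed_tiling u.
Proof.
move=> [i vi] uv; exists (j + i)%N; rewrite mulnDl; apply/supertileDP.
by exists v.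
Qed.

(** By primitivity the patch sits in a supertile of the type of [t0] and of level a multiple of [N];
    it remains to translate that supertile onto the one of [t0]. *)
Lemma legal_in_seed_tiling Q : legal S Q ->
  exists x, translate x Q `<=` seed_tiling.
Proof.
move=> [n [t Qt]]; have [m0 H] := exists_ancestor Sprim.
have [N0 _ _] := seed.
pose j := (n + m0)%N.
have jN : (n + m0 <= j * N)%N by rewrite -{1}[(n + m0)%N]muln1 leq_mul2l N0 orbT.
have [|s st ts] := H (j * N - n)%N t t0.1; first by rewrite leq_subRL; lia.
have Qs u : Q u -> u \in supertile S (j * N) s.
  move=> /Qt ut; rewrite -(@subnKC n (j * N)); last lia.
  by apply/supertileDP; exists t.
exists (lam ^+ (j * N) *: (t0.2 - s.2)) => u /translateP/Qs us; exists j.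
have -> : t0 = shift_tile (t0.2 - s.2) s.
  by rewrite /shift_tile st addrC subrK; case: (t0).
by rewrite -(shift_tileNK (lam ^+ (j * N) *: (t0.2 - s.2)) u) supertile_shift.
Qed.

End Seed.

Hypothesis Sflc : finite_local_complexity S.

(** Finite local complexity concerns patches of tilings in the space, so a legal patch is first
    moved into the seed tiling. *)
Lemma legal_finite_classes (r : R) : 0 <= r ->
  exists2 F : seq (set tile), (forall Q, Q \in F -> legal S Q) &
    forall Q y, legal S Q -> (forall u, Q u -> `|u.2 - y| <= r) ->
    exists2 Q', Q' \in F & exists x, Q = translate x Q'.
Proof.
move=> r0; have D0 := outer_radius_gt0 S.
have [N [t0 seed]] := exists_self_similar_seed.
(* Punctures within [r] of [y] give supports of sup-norm diameter at most [2 * (r + D)]; the factor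
   [d] passes to the Euclidean diameter, and 1 makes the bound positive. *)
pose rho : R := d%:R * (2 * (r + D)) + 1.
have rho0 : 0 < rho by rewrite ltr_wpDl// !mulr_ge0//; lra.
have [F /finite_seqP[F' FE] HF] := Sflc rho0.
exists [seq Q <- F' | `[< legal S Q >]].
  by move=> Q; rewrite mem_filter => /andP[/asboolP].
move=> Q y lQ Qy; have [x xQ] := legal_in_seed_tiling seed lQ.
have [|Q' FQ' [x' xE]] := HF _ _ (tiling_space_seed seed) xQ.
  rewrite ge_max lee_fin (ltW rho0)/=; apply: ge_ereal_sup => _ [[a b] [/= Qa Qb] <-].
  rewrite lee_fin; apply: le_trans (enorm_le _) _.
  have H c : supports S (translate x Q) c -> `|c - (y + x)| <= r + D.
    move=> [u /translateP Qu uc]; have := Qy _ Qu; have := support_outer uc => /=.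
    have -> : c - (y + x) = (c - u.2) + (u.2 - x - y).
      by rewrite !addrA subrK opprD addrA addrAC.
    by move=> h1 h2; rewrite (le_trans (ler_normD _ _))//; lra.
  have : `|a - b| <= 2 * (r + D).
    have -> : a - b = (a - (y + x)) - (b - (y + x)) by rewrite opprB addrA subrK.
    by rewrite (le_trans (ler_normB _ _))//; have := H _ Qa; have := H _ Qb; lra.
  by move=> h; rewrite /rho ler_wpDr// ler_wpM2l.
have QE : Q = translate (x' - x) Q'.
  apply/seteqP; split=> u; rewrite translateP => H.
    suff : translate x Q (shift_tile x u).
      by rewrite xE translateP shift_tileD opprB.
    by apply/translateP; rewrite shift_tileK.
  suff : translate x Q (shift_tile x u) by rewrite translateP shift_tileK.
  by rewrite xE translateP shift_tileD -opprB.
exists Q'; last by exists (x' - x).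
rewrite mem_filter; apply/andP; split; last by move: FQ'; rewrite FE.
by apply/asboolP; move: lQ; rewrite QE legal_translate_iff.
Qed.

Lemma tiles_meeting_outer r W u : tiles_meeting S r W u -> `|u.2| <= r + D.
Proof.
move=> [_ [z [/support_outer uz]]]; rewrite /eball/= => zr.
have -> : u.2 = z - (z - u.2) by rewrite opprB addrCA subrr addr0.
by rewrite (le_trans (ler_normB _ _))// lerD// (le_trans (norm_le_enorm _)).
Qed.

Lemma finite_tiles T r : is_patch S T -> 0 <= r ->
  finite_set [set u | T u /\ `|u.2| <= r].
Proof.
move=> Tp r0; apply: (@finite_packing R d _ (fun u : tile => u.2) _ eta r) => //.
- exact: inner_radius_gt0.
- by move=> u [].
- by move=> u v [Tu _] [Tv _] uv; exact/puncture_sep/Tp.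
Qed.

(** A larger patch of [T] is legal, so it lies in a deep supertile. Conversely, a tile of that
    supertile meeting the ball has its puncture in a region already covered by the larger patch, so
    [patch_cover_mem] identifies it as one of its tiles. *)
Lemma tiling_patch_supertile T r n : tiling_space S T -> 0 <= r ->
  exists m t, (n <= m)%N /\
    tiles_meeting S r T = tiles_meeting S r [set` supertile S m t].
Proof.
move=> [[Tp Tc] Tl] r0; have D0 := outer_radius_gt0 S.
(* Tiles meeting the ball have punctures within [r + D]; the tiles covering the open ball of radius
   [r + D + 1] have theirs within a further [D]. *)
set P := [set u | T u /\ `|u.2| <= r + D + 1 + D].
have fP : finite_set P by apply: finite_tiles => //; lra.
have /legalP lP := Tl P fP (fun u H => H.1).
have [m [t [nm Pt]]] := legal_deep Sprim n lP.
exists m, t; split=> //; apply/seteqP; split=> u [uT umeet].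
  split=> //; apply: Pt; split=> //.
  by have : tiles_meeting S r T u by []; move=> /tiles_meeting_outer; lra.
have um : `|u.2| <= r + D.
  exact: (@tiles_meeting_outer r [set` supertile S m t]).
split=> //; suff [] : P u by [].
have /finite_seqP[s sE] := fP.
rewrite sE; apply: (@patch_cover_mem _ _ _ S [set` supertile S m t] s
  [set z | `|z| < r + D + 1] _ u.2) => //.
- exact: supertile_patch.
- by move=> v vs; apply: Pt; rewrite sE.
- have -> : [set z : 'rV[R]_d | `|z| < r + D + 1] = ball 0 (r + D + 1).
    by rewrite -ball_normE; apply/seteqP; split=> z /=; rewrite sub0r normrN.
  exact: ball_open.
- move=> z zr; have : supports S T z by rewrite Tc.
  move=> [v Tv vz]; exists v => //; suff : P v by rewrite sE.
  split=> //; have -> : v.2 = z - (z - v.2) by rewrite opprB addrCA subrr addr0.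
  rewrite (le_trans (ler_normB _ _))// lerD//; first exact: ltW.
  exact: support_outer.
- by move=> /=; lra.
- exact: interior_puncture.
Qed.

(** A patch of radius [lam ^+ n] is determined by the translation class of the cluster of level-[n]
    supertiles that meet the ball and by the tile of the cluster placed at the origin. There are
    finitely many classes, each with [O(lam ^ (n d))] tiles. *)
Lemma patch_complexity : exists2 C, 0 < C & forall n,
  exists2 s : seq (set tile), (size s)%:R <= C * (lam ^+ n) ^+ d &
  forall T, canonical_transversal S T -> tiles_meeting S (lam ^+ n) T \in s.
Proof.
have D0 := outer_radius_gt0 S.
have [|F Flegal HF] := @legal_finite_classes (1 + D); first lra.
have [C C0 HC] := size_supertile_le S.
pose e Q : seq tile := fset_set Q.
have eE Q : legal S Q -> [set` e Q] = Q.
  by move=> /finite_legal fQ; rewrite /e fset_setK.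
exists ((\sum_(Q <- F) (size (e Q))%:R + 1) * C ^+ d).
  by rewrite mulr_gt0 ?exprn_gt0// ltr_wpDl// sumr_ge0.
move=> n; pose U Q := flatten [seq supertile S n v | v <- e Q].
pose r := lam ^+ n.
pose c Q (w : tile) := tiles_meeting S r (translate (- w.2) [set` U Q]).
exists (flatten [seq [seq c Q w | w <- U Q] | Q <- F]).
  rewrite size_flatten /shape -map_comp sumnE big_map natr_sum.
  have X0 : 0 <= C ^+ d * (lam ^+ n) ^+ d.
    by rewrite mulr_ge0// exprn_ge0// ltW ?expansionX_gt0.
  rewrite -mulrA mulrDl mul1r ler_wpDr// -exprMn mulr_suml; apply: ler_sum => Q _ /=.
  rewrite size_map size_flatten /shape -map_comp sumnE big_map natr_sum.
  apply: (@le_trans _ _ (\sum_(v <- e Q) (C * lam ^+ n) ^+ d)).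
    by apply: ler_sum => v _ /=.
  by rewrite big_const_seq count_predT iter_addr_0 mulr_natl.
move=> T [TS [t0 Tt0 t00]].
have r0 : 0 < r by exact: expansionX_gt0.
have [m [t [nm TE]]] := tiling_patch_supertile n TS (ltW r0).
(* Contracted by [lam ^+ n], the ball has radius at most 1, so the punctures of the cluster lie
   within [1 + D], independently of [n]. *)
pose Q := [set v | v \in supertile S (m - n) t /\
  exists2 z, enorm z <= r & support S v ((lam ^+ n)^-1 *: z)].
have lQ : legal S Q by exists (m - n)%N, t => v [].
have [|Q0 FQ0 [x QE]] := HF Q 0 lQ.
  move=> v [_ [z zr vz]]; rewrite subr0.
  have -> : v.2 = (lam ^+ n)^-1 *: z - ((lam ^+ n)^-1 *: z - v.2).
    by rewrite opprB addrCA subrr addr0.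
  rewrite (le_trans (ler_normB _ _))// lerD//; last exact: support_outer.
  rewrite normrZ gtr0_norm ?invr_gt0// mulrC ler_pdivrMr// mul1r.
  exact: le_trans (norm_le_enorm _) zr.
have lQ0 := Flegal _ FQ0.
have TE' : tiles_meeting S r T =
    tiles_meeting S r (translate (lam ^+ n *: x) [set` U Q0]).
  rewrite TE; apply/seteqP; split=> u [ut umeet]; split=> //.
    have [z [uz zr]] := umeet.
    move: ut; rewrite /= -(subnKC nm) => /supertileDP[v vt uv].
    have : Q v.
      split=> //; exists z => //.
      by apply/supertile_support; exists u.
    rewrite QE => /translateP Q0v; apply/translateP; apply/flatten_mapP.
    exists (shift_tile (- x) v); first by move: Q0v; rewrite -[X in X _]eE.
    by rewrite -scalerN supertile_shift.
  move: ut => /translateP/flatten_mapP[v vQ0 uv] /=.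
  have : Q (shift_tile x v).
    rewrite QE; apply/translateP; rewrite shift_tileK -[X in X _]eE//.
  move=> [vt _]; rewrite -(subnKC nm); apply/supertileDP.
  exists (shift_tile x v) => //.
  by rewrite -(shift_tileNK (lam ^+ n *: x) u) supertile_shift.
(* The tile punctured at the origin singles out the tile of [U Q0] on which to centre the patch. *)
have : tiles_meeting S r T t0.
  split=> //; exists 0; split.
    by apply: support_inner; rewrite -[t0.2]/(puncture t0) t00 subrr normr0 inner_radius_gt0.
  rewrite /eball/= (le_trans (enorm_le _))// normr0 mulr0 ltW//.
rewrite TE' => -[/translateP wU _].
apply/flatten_mapP; exists Q0 => //; apply/mapP.
exists (shift_tile (- (lam ^+ n *: x)) t0) => //.
rewrite /c /= -[t0.2]/(puncture t0) t00 sub0r opprK//.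
Qed.

End SelfSimilar.

(** * The upper bound for the Hausdorff dimension *)

Section Distance.
Variables (R : realType) (d k : nat) (S : substitution R d k).
Local Notation tile := (tile R d k).
Local Notation dist := (transversal_dist S).
Implicit Types (T : set tile) (r : R).

Lemma tiles_meeting_mono r r' T T' : r <= r' ->
  tiles_meeting S r' T = tiles_meeting S r' T' ->
  tiles_meeting S r T = tiles_meeting S r T'.
Proof.
move=> rr'.
have H T1 T2 : tiles_meeting S r' T1 = tiles_meeting S r' T2 ->
    tiles_meeting S r T1 `<=` tiles_meeting S r T2.
  move=> E u [Tu [z [uz zr]]].
  have : tiles_meeting S r' T1 u.
    by split=> //; exists z; split=> //; exact: le_trans zr rr'.
  by rewrite E => -[T2u _]; split=> //; exists z.
by move=> E; apply/seteqP; split; apply: H.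
Qed.

(** Each tile meets every ball that contains its puncture, so agreement at arbitrarily large radii
    would force equality. *)
Lemma agreement_has_ubound T T' : T <> T' ->
  has_ubound [set r | 0 <= r /\ tiles_meeting S r T = tiles_meeting S r T'].
Proof.
move=> TT'; apply: contrapT => nub; apply: TT'.
have H (u : tile) : exists2 r, enorm u.2 <= r & tiles_meeting S r T = tiles_meeting S r T'.
  apply: contrapT => no; apply: nub; exists (enorm u.2) => r [r0 rE].
  by rewrite leNgt; apply/negP => /ltW ur; apply: no; exists r.
apply/seteqP; split=> u Tu; have [r ur rE] := H u.
  suff : tiles_meeting S r T u by rewrite rE => -[].
  split=> //; exists u.2; split=> //.
  by apply: support_inner; rewrite subrr normr0 inner_radius_gt0.
suff : tiles_meeting S r T' u by rewrite -rE => -[].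
split=> //; exists u.2; split=> //.
by apply: support_inner; rewrite subrr normr0 inner_radius_gt0.
Qed.

Lemma agreement_radius_ge0 T T' : 0 <= agreement_radius S T T'.
Proof.
have [TT'|/agreement_has_ubound ub] := pselect (T = T'); last first.
  rewrite /agreement_radius; set A := (X in sup X).
  have [->|/set0P[r Ar]] := eqVneq A set0; first by rewrite sup0.
  by apply: le_trans (ub_le_sup ub Ar); case: Ar.
(* For [T = T'] the set of radii is unbounded and [sup] takes its default value [0]. *)
rewrite /agreement_radius sup_out// => -[_ [M HM]].
have := HM (`|M| + 1); rewrite TT' => /(_ _)/wrap[|].
  by split=> //; rewrite addr_ge0.
by have := ler_norm M; lra.
Qed.

Lemma transversal_dist_le r T T' : 0 <= r ->
  tiles_meeting S r T = tiles_meeting S r T' -> dist T T' <= (1 + r)^-1.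
Proof.
move=> r0 E; rewrite /transversal_dist; case: asboolP => [_|TT'].
  by rewrite invr_ge0 addr_ge0.
have rR : r <= agreement_radius S T T'.
  by apply: ub_le_sup; [exact: agreement_has_ubound|].
by rewrite div1r lef_pV2 ?posrE ?lerD2l//; lra.
Qed.

(** The strict inequality puts [r] below the supremum of the agreement radii, which need not be
    attained; some agreement radius then exceeds [r]. *)
Lemma transversal_dist_lt r T T' : 0 <= r ->
  dist T T' < (1 + r)^-1 -> tiles_meeting S r T = tiles_meeting S r T'.
Proof.
move=> r0; rewrite /transversal_dist; case: asboolP => [-> //|TT'].
have R0 := agreement_radius_ge0 T T'.
rewrite div1r ltf_pV2 ?posrE ?ltrD2l; [|lra|lra] => rR.
rewrite /agreement_radius in rR; set A := (X in sup X) in rR.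
have [A0|/set0P[r1 Ar1]] := eqVneq A set0.
  by move: rR; rewrite A0 sup0 ltNge r0.
have e0 : 0 < sup A - r by rewrite subr_gt0.
have [|r' [_ E] ] := sup_adherent e0 (_ : has_sup A).
  by split; [exists r1|exact: agreement_has_ubound].
by rewrite opprB addrC subrK => /ltW rr'; exact: tiles_meeting_mono rr' E.
Qed.

Lemma diameter_ge0 (E : set (set tile)) : (0%E <= diameter dist E)%E.
Proof. by rewrite le_max lexx. Qed.

Lemma le_diameter (E : set (set tile)) T T' : E T -> E T' ->
  ((dist T T')%:E <= diameter dist E)%E.
Proof.
move=> ET ET'; rewrite le_max; apply/orP; right.
by apply: ereal_sup_ubound; exists (T, T').
Qed.

Lemma diameter_le (E : set (set tile)) (b : R) : 0 <= b ->
  (forall T T', E T -> E T' -> dist T T' <= b) -> (diameter dist E <= b%:E)%E.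
Proof.
move=> b0 H; rewrite ge_max lee_fin b0/=; apply: ge_ereal_sup.
by move=> _ [[T T'] [/= ET ET'] <-]; rewrite lee_fin H.
Qed.

Lemma hausdorff_weight_ge0 (s : R) E : (0%E <= hausdorff_weight dist s E)%E.
Proof. by rewrite /hausdorff_weight; case: ifP => // _; exact: poweR_ge0. Qed.

Lemma hausdorff_weight_le (s b : R) E : 0 <= s -> 0 <= b ->
  (diameter dist E <= b%:E)%E -> (hausdorff_weight dist s E <= (powR b s)%:E)%E.
Proof.
move=> s0 b0 Eb; rewrite /hausdorff_weight; case: ifP => _.
  by rewrite lee_fin powR_ge0.
rewrite -poweR_EFin; apply: gt0_ler_poweR => //.
- by rewrite in_itv/= diameter_ge0 leey.
- by rewrite in_itv/= lee_fin b0 leey.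
Qed.

Lemma hausdorff_premeasure_ge0 (s del : R) E :
  (0%E <= hausdorff_premeasure dist s del E)%E.
Proof.
apply: le_ereal_inf_tmp => _ [U _ <-]; apply: nneseries_ge0 => i _ _.
exact: hausdorff_weight_ge0.
Qed.

End Distance.

Section UpperBound.
Variables (R : realType) (d k : nat) (S : substitution R d k).
Local Notation tile := (tile R d k).
Local Notation lam := (expansion S).
Local Notation dist := (transversal_dist S).
Local Notation Xi := (canonical_transversal S).
Hypotheses (k_gt0 : (0 < k)%N) (Sprim : primitive_subst S).
Hypothesis Sflc : finite_local_complexity S.

(** Cover by the cylinders of radius [lam ^+ n]: at most [C * lam ^ (n d)] sets of diameter at most
    [lam ^ (- n)], of total weight [C * lam ^ (n (d - s))], which tends to 0. *)
Lemma hausdorff_measure_eq0 (s : R) : d%:R < s -> hausdorff_measure dist s Xi = 0%E.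
Proof.
move=> ds; have s0 : 0 < s by exact: le_lt_trans ds.
have [C C0 HC] := patch_complexity k_gt0 Sprim Sflc.
suff pre0 del : 0 < del -> hausdorff_premeasure dist s del Xi = 0%E.
  apply/eqP; rewrite eq_le; apply/andP; split.
    by apply: ge_ereal_sup => _ [del del0 <-]; rewrite pre0.
  apply: le_trans (hausdorff_premeasure_ge0 S s 1 Xi) _.
  by apply: ereal_sup_ubound; exists 1 => /=.
move=> del0; apply/eqP; rewrite eq_le hausdorff_premeasure_ge0 andbT.
apply/lee_addgt0Pr => e e0; rewrite add0e.
have ds0 : 0 < s - d%:R by rewrite subr_gt0.
(* The first entry makes the diameters at most [del], the second makes the total weight at most
   [e]. *)
pose M := Num.max del^-1 (powR (C / e) (s - d%:R)^-1).
have [n Mn] := expr_unbounded M (expansion_gt1 S).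
have l0 := expansionX_gt0 S n.
have n_del : (lam ^+ n)^-1 <= del.
  rewrite -[del]invrK lef_pV2 ?posrE ?invr_gt0//.
  by apply/ltW; apply: le_lt_trans Mn; rewrite le_max lexx.
have n_e : C * (lam ^+ n) ^+ d * powR (lam ^+ n)^-1 s <= e.
  have Ce0 : 0 < C / e by rewrite divr_gt0.
  have : C / e <= powR (lam ^+ n) (s - d%:R).
    have E : C / e = powR (powR (C / e) (s - d%:R)^-1) (s - d%:R).
      by rewrite -powRrM mulVf ?gt_eqF// powRr1// ltW.
    rewrite [leLHS]E; apply: ge0_ler_powR; rewrite ?nnegrE ?powR_ge0 ?(ltW l0)//.
      exact: ltW.
    apply: ltW.
    by apply: le_lt_trans Mn; rewrite le_max lexx orbT.
  rewrite ler_pdivrMr// => H.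
  have -> : powR (lam ^+ n)^-1 s = (powR (lam ^+ n) s)^-1.
    by rewrite -powR_inv1 ?(ltW l0)// -powRrM mulN1r powRN.
  have -> : powR (lam ^+ n) s =
      powR (lam ^+ n) (s - d%:R) * (lam ^+ n) ^+ d.
    rewrite -[(lam ^+ n) ^+ d]powR_mulrn ?(ltW l0)// -powRD ?subrK//.
    by rewrite (gt_eqF l0) implybT.
  rewrite ler_pdivrMr ?mulr_gt0 ?powR_gt0 ?exprn_gt0 ?expansion_gt0//.
  by rewrite mulrA ler_pM2r ?exprn_gt0 ?expansion_gt0// mulrC.
have [sq ssz Hs] := HC n.
(* The finite cover is padded with empty sets, whose weight is 0. *)
pose U i : set (set tile) := if (i < size sq)%N then
  [set T | Xi T /\ tiles_meeting S (lam ^+ n) T = nth set0 sq i] else set0.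
have Ud i : (diameter dist (U i) <= ((lam ^+ n)^-1)%:E)%E.
  apply: diameter_le; first by rewrite invr_ge0 ltW.
  rewrite /U; case: ifP => // _ T T' [_ E] [_ E'].
  apply: le_trans (transversal_dist_le (ltW l0) _) _; first by rewrite E E'.
  by rewrite lef_pV2 ?posrE//; lra.
apply: (@le_trans _ _ (\sum_(0 <= i <oo) hausdorff_weight dist s (U i))%E).
  apply: ereal_inf_lbound; exists U => //; split.
  - by move=> i T; rewrite /U; case: ifP => // _ [].
  - move=> T XT; have := Hs _ XT; rewrite -index_mem => isz.
    exists (index (tiles_meeting S (lam ^+ n) T) sq) => //.
    by rewrite /U isz; split=> //; rewrite nth_index// -index_mem.
  - by move=> i; apply: le_trans (Ud i) _; rewrite lee_fin.
pose b := powR (lam ^+ n)^-1 s.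
have b0 : 0 <= b by exact: powR_ge0.
apply: lime_le.
  by apply: is_cvg_nneseries => i _ _; exact: hausdorff_weight_ge0.
near=> m; apply: (@le_trans _ _ ((minn m (size sq))%:R * b)%:E).
  elim: (m) => [|j ih]; first by rewrite big_geq// min0n mul0r.
  rewrite big_nat_recr//=; have [jsz|jsz] := ltnP j (size sq).
    rewrite (minn_idPl jsz) -natr1 mulrDl mul1r EFinD.
    rewrite (minn_idPl (ltnW jsz)) in ih; apply: leeD => //.
    apply: hausdorff_weight_le (Ud j); first exact: ltW.
    by rewrite invr_ge0 ltW.
  rewrite (minn_idPr (leqW jsz)); rewrite (minn_idPr jsz) in ih.
  rewrite [X in (_ + X)%E](_ : _ = 0%E) ?adde0//.
  by rewrite /hausdorff_weight /U ltnNge jsz/= asboolT.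
rewrite lee_fin; apply: le_trans n_e; rewrite ler_wpM2r//.
by apply: le_trans ssz; rewrite ler_nat geq_minr.
Unshelve. all: by end_near. Qed.

Lemma hausdorff_dim_le : (hausdorff_dim dist Xi <= (d%:R)%:E)%E.
Proof.
apply/lee_addgt0Pr => e e0; apply: ereal_inf_lbound.
exists (d%:R + e) => //; split; first by rewrite addr_ge0// ltW.
by apply: hausdorff_measure_eq0; rewrite ltrDl.
Qed.

End UpperBound.

(** * Repetitivity, repulsivity and the lower bound *)

Lemma expr_bracket (R : realType) (q X : R) : 1 < q -> 1 < X ->
  exists2 j, X <= q ^+ j & q ^+ j <= q * X.
Proof.
move=> q1 X1; have ex : exists j, X <= q ^+ j.
  by have [j /ltW] := expr_unbounded X q1; exists j.
case: (ex_minnP ex) => j Xj jmin; exists j => //.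
case: j Xj jmin => [|j]; first by rewrite expr0 leNgt X1.
move=> _ jmin; rewrite exprS ler_pM2l; last by apply: lt_trans q1.
by rewrite leNgt; apply/negP => /ltW/jmin; rewrite ltnn.
Qed.

Section LowerBound.
Variables (R : realType) (d k : nat) (S : substitution R d k).
Local Notation tile := (tile R d k).
Local Notation lam := (expansion S).
Local Notation eta := (inner_radius S).
Local Notation D := (outer_radius S).
Local Notation dist := (transversal_dist S).
Local Notation Xi := (canonical_transversal S).
Implicit Types (t u v : tile) (Q W T : set tile).
Hypotheses (d_gt0 : (0 < d)%N) (k_gt0 : (0 < k)%N) (Sprim : primitive_subst S).
Hypothesis Sflc : finite_local_complexity S.

Section Seed.
Variables (N : nat) (t0 : tile).
Hypothesis seed : self_similar_seed S N t0.
Local Notation T0 := (seed_tiling S N t0).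

(** By primitivity each patch occurs in supertiles of every type from some level on; a finite list
    has a common such level. *)
Lemma legal_seq_uniform_level (F : seq (set tile)) :
  (forall Q, Q \in F -> legal S Q) ->
  exists M0, forall Q M p, Q \in F -> (M0 <= M)%N ->
    exists2 s, s.1 = p & forall u, Q u -> u \in supertile S M s.
Proof.
have [m0 Hm0] := exists_ancestor Sprim.
elim: F => [|Q F ih] HF; first by exists 0%N.
have [|M1 HM1] := ih; first by move=> Q' FQ'; apply: HF; rewrite inE FQ' orbT.
have [n [t Qt]] : legal S Q by apply: HF; rewrite inE eqxx.
exists (maxn M1 (n + m0)) => Q' M p; rewrite inE => /orP[/eqP-> M_ge|FQ' M_ge].
  have nM : (n + m0 <= M)%N by apply: leq_trans M_ge; exact: leq_maxr.
  have [|s sp ts] := Hm0 (M - n)%N t p; first lia.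
  exists s => // u /Qt ut; rewrite -(@subnKC n M); last lia.
  by apply/supertileDP; exists t.
by apply: HM1 => //; apply: leq_trans M_ge; exact: leq_maxl.
Qed.

(** A patch of radius [lam ^+ n] lies in a cluster of level-[n] supertiles, of finitely many classes
    up to scaling. Each class occurs in every supertile of a fixed further level [M], so the patch
    recurs in the level-[(n + M)] supertile that covers [a]. *)
Lemma linear_repetitivity : exists2 K, 0 < K & forall j y a,
  exists2 x, (forall u, T0 u -> `|u.2 - y| <= lam ^+ (j * N) -> T0 (shift_tile x u)) &
    `|y + x - a| <= K * lam ^+ (j * N).
Proof.
have D0 := outer_radius_gt0 S.
have [|F Flegal HF] := @legal_finite_classes _ _ _ S k_gt0 Sprim Sflc (1 + D).
  by lra.
have [J HJ] := legal_seq_uniform_level Flegal.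
have lJ0 := expansionX_gt0 S (J * N).
(* Both [a] and a tile of the recurring patch are within [D * lam ^+ (n + M)] of the centre of that
   supertile; the 1 accounts for the radius of the patch. *)
exists (2 * D * lam ^+ (J * N) + 1) => [|j y a].
  by rewrite addr_gt0// !mulr_gt0.
pose n := (j * N)%N; rewrite -/n.
have ln0 := expansionX_gt0 S n.
pose P := [set u | T0 u /\ `|u.2 - y| <= lam ^+ n].
have [[u1 Pu1]|P0] := pselect (P !=set0); last first.
  exists (a - y); first by move=> u Tu uy; case: P0; exists u.
  by rewrite subrKC subrr normr0 mulr_ge0 ?(ltW ln0)// addr_ge0// !mulr_ge0// ltW.
have fP : finite_set P.
  apply: (@finite_packing R d _ (fun u : tile => u.2 - y) _ eta (lam ^+ n)).
  - exact: inner_radius_gt0.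
  - exact: ltW.
  - by move=> u [].
  - move=> u v [Tu _] [Tv _] uv; rewrite opprB addrA subrK.
    exact/puncture_sep/(seed_tiling_patch seed).
have lP : legal S P by apply: (seed_tiling_legal seed fP) => u [].
have [m [t [nm Pt]]] := legal_deep Sprim n lP.
pose Q := [set v | v \in supertile S (m - n) t /\
  exists2 u, P u & u \in supertile S n v].
have lQ : legal S Q by exists (m - n)%N, t => v [].
have [|Q0 FQ0 [x0 QE]] := HF Q ((lam ^+ n)^-1 *: y) lQ.
  move=> v [_ [u [_ uy] uv]]; have := puncture_supertile uv.
  have E : lam ^+ n * `|v.2 - (lam ^+ n)^-1 *: y| = `|lam ^+ n *: v.2 - y|.
    by rewrite -{1}(gtr0_norm ln0) -normrZ scalerBr scalerKV ?expansionX_neq0.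
  move=> pu; rewrite -(ler_pM2l ln0) E.
  have -> : lam ^+ n *: v.2 - y = (u.2 - y) - (u.2 - lam ^+ n *: v.2).
    by rewrite opprB [RHS]addrC addrA subrK.
  have := ler_normB (u.2 - y) (u.2 - lam ^+ n *: v.2).
  by rewrite mulrDr mulr1 [X in _ -> _ <= _ + X]mulrC; lra.
(* Levels are kept multiples of [N], so that supertiles of tiles of [T0] consist of tiles of
   [T0]. *)
pose M := (J * N)%N.
have JM : (J <= M)%N by have [N0 _ _] := seed; rewrite leq_pmulr.
have [v0 Tv0 av0] := seed_tiling_cover seed ((lam ^+ (n + M))^-1 *: a).
have [s sv0 Q0s] := HJ Q0 M v0.1 FQ0 JM.
pose w := v0.2 - s.2.
have v0E : v0 = shift_tile w s by rewrite /shift_tile sv0 subrKC; case: (v0).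
(* Undo the shift [x0] from [Q0] to [Q], follow the shift [w] from [s] to [v0], and inflate by
   [lam ^+ n]. *)
pose x := lam ^+ n *: (lam ^+ M *: w - x0).
have Px u : P u -> shift_tile x u \in supertile S (n + M) v0.
  move=> Pu; have := Pt _ Pu; rewrite -(subnKC nm) => /supertileDP[v vt uv].
  have : Q v by split=> //; exists u.
  rewrite QE => /translateP/Q0s vs; apply/supertileDP.
  exists (shift_tile (lam ^+ M *: w - x0) v); last by rewrite supertile_shift.
  by move: vs; rewrite -(supertile_shift S M w) -v0E shift_tileD addrC.
exists x.
  move=> u Tu uy; apply: (seed_tiling_supertile (j := j + J) Tv0).
  by rewrite mulnDl; exact: Px.
have lnM0 := expansionX_gt0 S (n + M).
have h1 := puncture_supertile (Px _ Pu1).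
have h2 : `|a - lam ^+ (n + M) *: v0.2| <= D * lam ^+ (n + M).
  have <- : lam ^+ (n + M) * `|(lam ^+ (n + M))^-1 *: a - v0.2| =
      `|a - lam ^+ (n + M) *: v0.2|.
    by rewrite -{1}(gtr0_norm lnM0) -normrZ scalerBr scalerKV ?expansionX_neq0.
  by rewrite mulrC ler_pM2r//; exact: support_outer.
have [_ h3] := Pu1.
have -> : y + x - a = ((shift_tile x u1).2 - lam ^+ (n + M) *: v0.2) -
    (a - lam ^+ (n + M) *: v0.2) - (u1.2 - y).
  rewrite /= opprB addrA subrK opprB [RHS]addrC addrA; congr (_ - _).
  by rewrite addrA subrK.
rewrite (le_trans (ler_normB _ _))//.
have -> : (2 * D * lam ^+ (J * N) + 1) * lam ^+ n =
    D * lam ^+ (n + M) + D * lam ^+ (n + M) + lam ^+ n by rewrite exprD; ring.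
by rewrite lerD// (le_trans (ler_normB _ _))// lerD.
Qed.

Hypothesis Saper : aperiodic_subst S.

(* Agreement of two translates on a ball propagates, by linear repetitivity,
   to the whole tiling, which would then be periodic. *)
Lemma repulsivity : exists2 c, 0 < c & forall a b r,
  T0 a -> T0 b -> a <> b -> 0 <= r ->
  (forall u, `|u.2| <= r -> T0 (shift_tile a.2 u) <-> T0 (shift_tile b.2 u)) ->
  c * (1 + r) <= `|a.2 - b.2|.
Proof.
have [e0 D0] := (inner_radius_gt0 S, outer_radius_gt0 S).
have [K K0 HK] := linear_repetitivity.
have [N0 _ _] := seed.
pose q := lam ^+ N.
have q1 : 1 < q by rewrite /q exprn_egt1 ?expansion_gt1// -lt0n.
(* Since [|x| >= eta], the additive [1 + D] is absorbed into [C1 * |x|]. The constant [K3] then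
   makes the agreement radius exceed [K * lam ^+ (j * N) + |x|] for the power just above
   [C1 * |x|]. *)
pose C1 := 1 + (1 + D) / eta.
have C10 : 0 < C1 by rewrite addr_gt0// divr_gt0// addr_gt0.
pose K3 := K * (q * C1) + 1.
have K30 : 0 < K3 by rewrite addr_gt0// !mulr_gt0//; lra.
exists (K3 + eta^-1)^-1.
  by rewrite invr_gt0 addr_gt0// invr_gt0.
move=> a b r Ta Tb ab r0 agree.
have K4 : 0 < K3 + eta^-1 by rewrite addr_gt0// invr_gt0.
rewrite mulrC ler_pdivrMr//.
have xeta : eta <= `|a.2 - b.2|.
  exact/puncture_sep/(seed_tiling_patch seed).
rewrite leNgt; apply/negP => rbig.
pose x := b.2 - a.2.
have xab : `|x| = `|a.2 - b.2| by rewrite distrC.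
have x0 : 0 < `|x| by rewrite xab; lra.
have x1 : 1 <= `|x| / eta by rewrite ler_pdivlMr// mul1r xab.
have rK3 : K3 * `|x| < r by move: rbig; rewrite -xab; nra.
have C1x : `|x| + (1 + D) <= C1 * `|x|.
  rewrite /C1 mulrDl mul1r lerD2l mulrAC -mulrA ler_peMr//; lra.
have [|j Lx Lq] := @expr_bracket R q (C1 * `|x|) q1; first lra.
rewrite -exprM mulnC in Lx Lq.
(* Invariance under [x'] near [a] spreads to any tile [t]: copy the patch around [t] next to [a],
   shift there by [x'], and recognise the result inside the copied patch. *)
have key x' : `|x'| <= `|x| ->
    (forall v, `|v.2 - a.2| <= K * lam ^+ (j * N) -> T0 v -> T0 (shift_tile x' v)) ->
    forall t, T0 t -> T0 (shift_tile x' t).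
  move=> x'x H t Tt; have [z Pz ta] := HK j t.2 a.2.
  have Ttz : T0 (shift_tile z t).
    by apply: Pz => //; rewrite subrr normr0 ltW// expansionX_gt0.
  have Ttzx := H (shift_tile z t) ta Ttz.
  (* The copied patch. It covers the ball of radius [|x| + 1] about the copy of [t], hence a
     neighbourhood of the puncture after the shift by [x']. *)
  pose P := [set v | T0 (shift_tile (- z) v) /\ `|v.2 - z - t.2| <= lam ^+ (j * N)].
  have fP : finite_set P.
    apply: (@finite_packing R d _ (fun v : tile => v.2 - z - t.2) _ eta (lam ^+ (j * N))) => //.
    - exact/ltW/expansionX_gt0.
    - by move=> u [].
    - move=> u v [Tu _] [Tv _] uv.
      have -> : u.2 - z - t.2 - (v.2 - z - t.2) =
          (shift_tile (- z) u).2 - (shift_tile (- z) v).2.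
        by rewrite /= opprB addrA subrK.
      apply: puncture_sep; apply: (seed_tiling_patch seed) => // E; apply: uv.
      by rewrite -(shift_tileNK z u) E shift_tileNK.
  have PT v : P v -> T0 v.
    by move=> [Tv vt]; rewrite -(shift_tileNK z v); apply: Pz => //=.
  suff : P (shift_tile x' (shift_tile z t)).
    move=> [+ _]; rewrite !shift_tileD; congr T0; congr shift_tile.
    by rewrite subrKC.
  have /finite_seqP[s sE] := fP.
  rewrite sE; apply: (@patch_cover_mem _ _ _ S T0 s
    (ball (t.2 + z) (`|x| + 1)) _ (t.2 + z + x')) => //.
  - exact: (seed_tiling_patch seed).
  - by move=> v vs; apply: PT; rewrite sE.
  - exact: ball_open.
  - move=> y; rewrite -ball_normE/= => yt.
    have [v Tv vy] := seed_tiling_cover seed (y - z).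
    exists (shift_tile z v); last exact/support_shift.
    suff : P (shift_tile z v) by rewrite sE.
    split; first by rewrite shift_tileK.
    rewrite /= addrK; have := support_outer vy.
    have -> : v.2 - t.2 = (y - z - t.2) - (y - z - v.2).
      by rewrite opprB [RHS]addrC addrA subrK.
    have : `|y - z - t.2| < `|x| + 1 by rewrite -addrA -opprD distrC [z + _]addrC.
    have := ler_normB (y - z - t.2) (y - z - v.2); lra.
  - by rewrite -ball_normE/= opprD addrA subrr sub0r normrN; lra.
  - exact: interior_puncture.
have KL : K * lam ^+ (j * N) + `|x| <= r.
  apply: ltW; apply: le_lt_trans rK3.
  rewrite /K3 mulrDl mul1r lerD2r -mulrA ler_pM2l//.
  by rewrite -mulrA.
have H1 : forall t, T0 t -> T0 (shift_tile x t).
  apply: key => // v va Tv.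
  have := (agree (shift_tile (- a.2) v)); rewrite shift_tileNK shift_tileD /=.
  move=> /(_ _)/wrap[|[+ _]]; first by lra.
  by move=> /(_ Tv); rewrite addrC.
have H2 : forall t, T0 t -> T0 (shift_tile (- x) t).
  apply: key; first by rewrite normrN.
  move=> v va Tv.
  have := (agree (shift_tile (- b.2) v)); rewrite shift_tileNK shift_tileD /=.
  move=> /(_ _)/wrap[|[_ +]].
    have -> : v.2 - b.2 = (v.2 - a.2) - x by rewrite opprB addrA subrK.
    by rewrite (le_trans (ler_normB _ _))//; lra.
  by move=> /(_ Tv); rewrite opprB addrC.
apply: (Saper (tiling_space_seed seed) (x := x)).
  by rewrite -normr_gt0.
apply/seteqP; split=> u.
  by move=> /translateP/H1; rewrite shift_tileNK.
by move=> /H2 h; apply/translateP.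
Qed.

Lemma canonical_transversal_seed a : T0 a -> Xi (translate (- a.2) T0).
Proof.
move=> Ta; split; last first.
  by exists (shift_tile (- a.2) a); [apply/translateP; rewrite shift_tileK|rewrite /puncture/= subrr].
split; first split.
- move=> u v /translateP Tu /translateP Tv uv; apply/seteqP; split=> // z [uz vz].
  have : shift_tile (- - a.2) u <> shift_tile (- - a.2) v.
    by move/(can_inj (shift_tileNK (- a.2))).
  move=> /(seed_tiling_patch seed Tu Tv)/seteqP[/(_ (z + a.2)) + _]; apply.
  by split; apply/interior_shift; rewrite opprK addrK.
- apply/seteqP; split=> // z _.
  have [u Tu uz] := seed_tiling_cover seed (z + a.2).
  exists (shift_tile (- a.2) u); first by apply/translateP; rewrite shift_tileK.
  by apply/support_shift; rewrite opprK.
- move=> Q fQ QT; apply/legalP.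
  suff : legal S (translate a.2 Q) by move/legal_translate_iff.
  apply: (seed_tiling_legal seed); first exact: finite_image.
  by move=> u /translateP/QT/translateP; rewrite opprK shift_tileNK.
Qed.

(** Assign each tile of a large supertile of [T0] to a cylinder containing the tiling centred at its
    puncture. By repulsivity the punctures assigned to cylinder [i] are separated by a multiple of
    [1 + r i], so packing bounds their number; dividing the total count by [L ^+ d] leaves a bound
    free of [L]. *)
Lemma cylinder_mass : exists2 kappa, 0 < kappa &
  forall n (V : nat -> set (set tile)) (r : nat -> R),
    (forall i, 0 <= r i) ->
    (forall T, Xi T -> exists2 i, (i < n)%N & V i T) ->
    (forall i T T', V i T -> V i T' ->
      tiles_meeting S (r i) T = tiles_meeting S (r i) T') ->
    kappa <= \sum_(i < n) ((1 + r i)^-1) ^+ d.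
Proof.
have [e0 D0] := (inner_radius_gt0 S, outer_radius_gt0 S).
have [c c0 Hc] := repulsivity.
have [c1 c10 Hc1] := size_supertile_ge S.
have dR0 : 0 < d%:R :> R by rewrite ltr0n.
(* Agreement on the Euclidean ball of radius [r i] gives agreement on the sup-norm ball of radius
   [r i / d], which is the one in [repulsivity]. *)
pose c2 := c / d%:R.
have c20 : 0 < c2 by rewrite divr_gt0.
pose C4 := 2 * (D / c2) + 3.
have C40 : 0 < C4 by rewrite addr_gt0// mulr_gt0// divr_gt0.
exists ((c1 / C4) ^+ d); first by rewrite exprn_gt0// divr_gt0.
move=> n V r r0 Vcov Vr.
have [N0 _ _] := seed.
have lN1 : 1 < lam ^+ N by rewrite exprn_egt1 ?expansion_gt1// -lt0n.
(* [L] exceeds every [1 + r i], so the additive 3 of the packing bound is absorbed. *)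
have [j Hj] := expr_unbounded (1 + \sum_(i < n) r i) lN1.
rewrite -exprM mulnC in Hj; set L := lam ^+ (j * N) in Hj *.
have L0 : 0 < L by exact: expansionX_gt0.
have rL (i : 'I_n) : 1 + r i <= L.
  apply/ltW; apply: le_lt_trans Hj; rewrite lerD2l (bigD1 i)//= lerDl sumr_ge0// => *.
have ex u : {i : 'I_n | T0 u -> V i (translate (- u.2) T0)}.
  apply: cid; have [Tu|nTu] := pselect (T0 u).
    have [i ilt Vi] := Vcov _ (canonical_transversal_seed Tu).
    by exists (Ordinal ilt).
  have [i ilt _] := Vcov _ (canonical_transversal_seed (ex_intro _ 0%N (mem_head _ _) : T0 t0)).
  by exists (Ordinal ilt).
pose idx u := sval (ex u).
have idxP u : T0 u -> V (idx u) (translate (- u.2) T0) by exact: svalP (ex u).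
pose X := supertile S (j * N) t0.
have XT u : u \in X -> T0 u by exists j.
have sizeX : (size X)%:R = \sum_(i < n) (size [seq u <- X | idx u == i])%:R :> R.
  rewrite -natr_sum; congr _%:R.
  under eq_bigr => i _ do rewrite size_filter -sum1_count.
  rewrite (exchange_big_dep predT)//= -sum1_size; apply: eq_bigr => u _.
  by rewrite (big_pred1 (idx u)).
have packi (i : 'I_n) : (size [seq u <- X | idx u == i])%:R <=
    (C4 * L * (1 + r i)^-1) ^+ d.
  have ri1 : 0 < 1 + r i by have := r0 i; lra.
  apply: (@le_trans _ _ ((2 * (D * L / (c2 * (1 + r i))) + 3) ^+ d)).
    apply: (@size_packing _ _ _ (fun u : tile => u.2 - L *: t0.2)).
    - exact/filter_uniq/uniq_supertile.
    - by rewrite mulr_gt0.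
    - by rewrite mulr_ge0// ltW.
    - by move=> u; rewrite mem_filter => /andP[_]; exact: puncture_supertile.
    - move=> u v; rewrite !mem_filter => /andP[/eqP ui /XT Tu] /andP[/eqP vi /XT Tv].
      move=> /eqP uv; rewrite opprB addrA subrK.
      apply: (@le_trans _ _ (c * (1 + r i / d%:R))).
        rewrite /c2 -mulrA ler_pM2l// mulrDr mulr1 lerD//; last by rewrite mulrC.
        by rewrite invf_le1// ler1n.
      apply: Hc => //; first by rewrite divr_ge0.
      move=> w wr.
      have agree := Vr i _ _ (_ : V i (translate (- u.2) T0))
        (_ : V i (translate (- v.2) T0)).
      have {agree} E := agree (eq_ind _ (fun i : 'I_n => V i _) (idxP _ Tu) _ ui)
        (eq_ind _ (fun i : 'I_n => V i _) (idxP _ Tv) _ vi).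
      have wm : support S w `&` @eball R d (r i) !=set0.
        exists w.2; split; first by apply: support_inner; rewrite subrr normr0.
        rewrite /eball/= (le_trans (enorm_le _))// mulrC -ler_pdivlMr//.
      split=> Tw.
        have : tiles_meeting S (r i) (translate (- u.2) T0) w.
          by split=> //; apply/translateP; rewrite opprK.
        by rewrite E => -[/translateP]; rewrite opprK.
      have : tiles_meeting S (r i) (translate (- v.2) T0) w.
        by split=> //; apply/translateP; rewrite opprK.
      by rewrite -E => -[/translateP]; rewrite opprK.
  have L1 : 1 <= L / (1 + r i) by rewrite ler_pdivlMr// mul1r.
  rewrite lerXn2r ?nnegrE//; first 2 last.
  - have -> : D * L / (c2 * (1 + r i)) = D / c2 * (L / (1 + r i)).
      by rewrite invfM mulrACA.
    by rewrite /C4 -[leRHS]mulrA; lra.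
  - by rewrite addr_ge0// mulr_ge0// divr_ge0// ?mulr_ge0// ltW.
  - by rewrite !mulr_ge0// ltW// ?invr_gt0.
have := Hc1 (j * N)%N t0; rewrite -/X -/L sizeX => H.
have {H} : (c1 * L) ^+ d <= \sum_(i < n) (C4 * L * (1 + r i)^-1) ^+ d.
  by apply: le_trans H _; exact: ler_sum.
under eq_bigr do rewrite exprMn.
rewrite -mulr_sumr !exprMn => H.
rewrite exprVn -[leRHS]mulr1 ler_pdivrMr ?exprn_gt0// mulr1.
have Ld0 : 0 < L ^+ d by rewrite exprn_gt0.
by move: H; rewrite mulrAC ler_pM2r// mulrC.
Qed.

End Seed.

End LowerBound.

(** * Compactness of the transversal *)

Section Compactness.
Variables (R : realType) (d k : nat) (S : substitution R d k).
Local Notation tile := (tile R d k).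
Local Notation lam := (expansion S).
Local Notation Xi := (canonical_transversal S).
Local Notation tm := (tiles_meeting S).
Hypotheses (k_gt0 : (0 < k)%N) (Sprim : primitive_subst S).
Hypothesis Sflc : finite_local_complexity S.
Variables (V : nat -> set (set tile)) (r : nat -> R).
Hypothesis Vcov : forall T, Xi T -> exists i, V i T.
Hypothesis Vsat : forall i T T', Xi T' -> V i T ->
  tm (r i) T = tm (r i) T' -> V i T'.

Definition uncovered (B : set (set tile)) :=
  forall n, exists2 T, Xi T /\ B T & forall i, (i < n)%N -> ~ V i T.

(** Only finitely many patches of radius [lam ^+ n] occur; if each corresponding piece of [B] had a
    finite subcover, the largest index would serve for [B]. *)
Lemma uncovered_refine n B : uncovered B ->
  exists c, uncovered (B `&` [set T | tm (lam ^+ n) T = c]).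
Proof.
move=> UB; have [C _ /(_ n)[s _ Hs]] := patch_complexity k_gt0 Sprim Sflc.
apply: contrapT => none.
have cov c : exists m, forall T, Xi T -> B T -> tm (lam ^+ n) T = c ->
    exists2 i, (i < m)%N & V i T.
  apply: contrapT => nocov; apply: none; exists c => m.
  apply: contrapT => H; apply: nocov; exists m => T XT BT Tc.
  apply: contrapT => noi; apply: H; exists T; first by split.
  by move=> i im Vi; apply: noi; exists i.
have [m Hm] := choice cov.
have [T [XT BT] HT] := UB (\max_(c <- s) m c)%N.
have [i im Vi] := Hm _ T XT BT erefl.
apply: (HT i) => //; apply: leq_trans im _.
by apply: (leq_bigmax_seq _ (Hs _ XT)).
Qed.

(** König's argument: fix the patches of radius [lam ^+ n] one after another, keeping an uncovered
    set, and take the union of these patches. The limit lies in [Xi], hence in some [V i]; as [V i]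
    depends only on the patch of radius [r i], it also contains tilings of an uncovered set. *)
Lemma transversal_finite_subcover :
  exists n, forall T, Xi T -> exists2 i, (i < n)%N & V i T.
Proof.
apply: contrapT => nofin.
have UT : uncovered setT.
  move=> n; apply: contrapT => H; apply: nofin; exists n => T XT.
  apply: contrapT => noi; apply: H; exists T => // i im Vi; apply: noi; by exists i.
have step nB : exists c, uncovered nB.2 ->
    uncovered (nB.2 `&` [set T | tm (lam ^+ nB.1) T = c]).
  have [UB|nUB] := pselect (uncovered nB.2); last by exists set0.
  by have [c Hc] := uncovered_refine nB.1 UB; exists c.
have [g Hg] := choice step.
pose fix B n : set (set tile) :=
  if n is m.+1 then B m `&` [set T | tm (lam ^+ m) T = g (m, B m)] else setT.
pose c n := g (n, B n).
have UB n : uncovered (B n) by elim: n => // n /(Hg (n, B n)).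
have Bc n m T : (m < n)%N -> B n T -> tm (lam ^+ m) T = c m.
  elim: n => // n ih; rewrite ltnS leq_eqVlt => /orP[/eqP->|mn] [] //.
  by move=> /(ih mn).
have exT n : exists T, Xi T /\ forall m, (m <= n)%N -> tm (lam ^+ m) T = c m.
  have [T [XT BT] _] := UB n.+1 0%N.
  by exists T; split=> // m mn; exact: Bc BT.
have lam_mono m n : (m <= n)%N -> lam ^+ m <= lam ^+ n.
  by move=> mn; rewrite ler_eXn2l// expansion_gt1.
have c_mono m n : (m <= n)%N -> c m `<=` c n.
  move=> mn u; have [T [XT HT]] := exT n.
  rewrite -(HT _ mn) -(HT _ (leqnn n)) => -[Tu [z [uz zr]]].
  by split=> //; exists z; split=> //; apply: le_trans zr (lam_mono _ _ mn).
pose Tlim : set tile := \bigcup_n c n.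
have limE n : tm (lam ^+ n) Tlim = c n.
  apply/seteqP; split=> u; last first.
    move=> cu; split; first by exists n.
    have [T [XT HT]] := exT n.
    by move: cu; rewrite -(HT _ (leqnn n)) => -[].
  move=> [[m _ cmu] umeet]; have [/c_mono|/ltnW nm] := leqP m n; first exact.
  have [T [XT HT]] := exT m; move: cmu; rewrite -(HT _ (leqnn m)) -(HT _ nm).
  by move=> [].
have finc (Q : set tile) : finite_set Q -> Q `<=` Tlim -> exists n, Q `<=` c n.
  move=> /finite_seqP[s ->]; elim: s => [|u s ih] sT; first by exists 0%N.
  have [m _ cmu] : Tlim u by apply: sT; rewrite /= inE eqxx.
  have [n Hn] : exists n, [set` s] `<=` c n.
    by apply: ih => v vs; apply: sT; rewrite /= inE vs orbT.
  exists (maxn m n) => v /=; rewrite inE => /orP[/eqP->|vs].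
    exact: c_mono (leq_maxl m n) _ cmu.
  exact: c_mono (leq_maxr m n) _ (Hn _ vs).
have XTlim : Xi Tlim.
  split; first split; first split.
  - move=> u v Tu Tv; have [||n Hn] := finc [set u; v].
    + exact: finite_set2.
    + by move=> w [->|->].
    have [T [[[[Tp _] _] _] HT]] := exT n.
    have Tc w : c n w -> T w by rewrite -(HT _ (leqnn n)) => -[].
    by apply: Tp; apply: Tc; apply: Hn; [left|right].
  - apply/seteqP; split=> // z _.
    have [n zn] := expr_unbounded (enorm z) (expansion_gt1 S).
    have [T [[[[_ Tc] _] _] HT]] := exT n.
    have : supports S T z by rewrite Tc.
    move=> [u Tu uz]; exists u => //; exists n => //.
    rewrite -(HT _ (leqnn n)); split=> //; exists z; split=> //.
    by rewrite /eball/= ltW.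
  - move=> Q fQ QT; have [n Qn] := finc Q fQ QT.
    have [T [[[_ Tl] _] HT]] := exT n; apply: Tl => // u /Qn.
    by rewrite -(HT _ (leqnn n)) => -[].
  have [T [[_ [t Tt t0]] HT]] := exT 0%N; exists t => //; exists 0%N => //.
  rewrite -(HT _ (leqnn 0)); split=> //; exists 0; split.
    apply: support_inner; rewrite -[t.2]/(puncture t) t0 subrr normr0.
    exact: inner_radius_gt0.
  by rewrite /eball/= (le_trans (enorm_le _))// normr0 mulr0 ltW// expansionX_gt0.
(* A tiling of [B n.+1] missed by the sets up to [V i] agrees with the limit up to
   [lam ^+ n >= r i], so it belongs to [V i] after all. *)
have [i Vi] := Vcov XTlim.
have [n /ltW rn] := expr_unbounded (r i) (expansion_gt1 S).
have [T [XT BT] HT] := UB n.+1 i.+1.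
apply: (HT i) => //; apply: Vsat XT Vi _; apply: tiles_meeting_mono rn _.
by rewrite limE (Bc n.+1).
Qed.

End Compactness.

(** * The lower bound and the value of the dimension *)

Section HausdorffDimension.
Variables (R : realType) (d k : nat) (S : substitution R d k).
Local Notation tile := (tile R d k).
Local Notation dist := (transversal_dist S).
Local Notation Xi := (canonical_transversal S).
Hypotheses (d_gt0 : (0 < d)%N) (k_gt0 : (0 < k)%N) (Sprim : primitive_subst S).
Hypotheses (Sflc : finite_local_complexity S) (Saper : aperiodic_subst S).

(** Thicken the sets of a cover to cylinders, extract a finite subcover and apply [cylinder_mass].
    Diameters are below 1, so [del ^ d <= del ^ s] and every cover keeps weight at least [b]. *)
Lemma hausdorff_measure_neq0 (s : R) : 0 <= s -> s < d%:R ->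
  hausdorff_measure dist s Xi <> 0%E.
Proof.
move=> s0 sd.
have [N [t0 seed]] := exists_self_similar_seed k_gt0 Sprim.
have [kappa kappa0 Hkappa] := cylinder_mass d_gt0 k_gt0 Sprim Sflc seed Saper.
pose b := kappa / 2 / 2 ^+ d.
have b0 : 0 < b by rewrite !divr_gt0// exprn_gt0.
suff pre_ge : (b%:E <= hausdorff_premeasure dist s 4^-1 Xi)%E.
  move=> H0; have : (b%:E <= 0)%E.
    rewrite -H0; apply: le_trans pre_ge _; apply: ereal_sup_ubound.
    by exists 4^-1 => //=; rewrite invr_gt0.
  by rewrite lee_fin leNgt b0.
apply: le_ereal_inf_tmp => _ [U [UX Ucov Udiam] <-].
pose del i := fine (diameter dist (U i)).
have delE i : diameter dist (U i) = (del i)%:E.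
  rewrite /del fineK// ge0_fin_numE ?diameter_ge0//.
  by apply: le_lt_trans (Udiam i) _; rewrite ltry.
have del0 i : 0 <= del i by rewrite -lee_fin -delE diameter_ge0.
have del4 i : del i <= 4^-1 by rewrite -lee_fin -delE.
pose m := Num.min 1 kappa.
have m0 : 0 < m by rewrite lt_min ltr01 kappa0.
have m1 : m <= 1 by rewrite ge_min lexx.
have mk : m <= kappa by rewrite ge_min lexx orbT.
(* A summable slack of total at most [kappa / 2]; it gives sets of diameter 0 a cylinder of finite
   radius. *)
pose e i := m / 2 ^+ i.+2.
have e0 i : 0 < e i by rewrite divr_gt0// exprn_gt0.
have e1 i : e i <= 2^-1.
  rewrite /e; apply: (@le_trans _ _ (1 / 2 ^+ i.+2)).
    by rewrite ler_pM2r// invr_gt0 exprn_gt0.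
  rewrite div1r lef_pV2 ?posrE ?exprn_gt0// exprS ler_peMr//.
  by rewrite exprn_ege1// ler1n.
have sume n : \sum_(i < n) e i <= m / 2.
  suff -> : \sum_(i < n) e i = m / 2 - m / 2 ^+ n.+1.
    by rewrite lerBlDr lerDl divr_ge0 ?ltW// exprn_gt0.
  elim: n => [|n ih]; first by rewrite big_ord0 expr1 subrr.
  rewrite big_ord_recr/= ih /e (exprS _ n.+1) invfM.
  by field; rewrite expf_neq0.
(* Strictly larger than [del i], as [transversal_dist_lt] demands, and at most 1/2 because the cover
   has mesh 1/4, so that the radius [r i] is nonnegative. *)
pose del' i := Num.max (2 * del i) (e i).
have del'0 i : 0 < del' i by rewrite lt_max e0 orbT.
have del'2 i : del' i <= 2^-1.
  by rewrite ge_max e1 andbT; have := del4 i; lra.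
have deldel' i : del i < del' i.
  rewrite lt_max; have := del0 i; rewrite le_eqVlt => /orP[/eqP<-|h].
    by rewrite e0 orbT.
  by rewrite (_ : del i < 2 * del i)//; lra.
pose r i := (del' i)^-1 - 1.
have r0 i : 0 <= r i.
  rewrite subr_ge0 invf_ge1//; apply: le_trans (del'2 i) _; lra.
have r1 i : (1 + r i)^-1 = del' i by rewrite /r addrC subrK invrK.
pose V i : set (set tile) :=
  [set T | Xi T /\ exists2 T1, U i T1 & tiles_meeting S (r i) T = tiles_meeting S (r i) T1].
have Ucyl i T T' : U i T -> U i T' ->
    tiles_meeting S (r i) T = tiles_meeting S (r i) T'.
  move=> UT UT'; apply: transversal_dist_lt => //; rewrite r1.
  apply: le_lt_trans (deldel' i); rewrite -lee_fin -delE.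
  exact: le_diameter.
have [||n Hn] := @transversal_finite_subcover _ _ _ S k_gt0 Sprim Sflc V r.
- by move=> T XT; have [i _ Ui] := Ucov _ XT; exists i; split=> //; exists T.
- by move=> i T T' XT' [_ [T1 UT1 E]] E'; split=> //; exists T1 => //; rewrite -E'.
have := Hkappa n V r r0 Hn; move=> /(_ _)/wrap[|].
  by move=> i T T' [_ [T1 UT1 ->]] [_ [T2 UT2 ->]]; exact: Ucyl.
under eq_bigr do rewrite r1.
pose w i := hausdorff_weight dist s (U i).
have w0 i : (0%E <= w i)%E by exact: hausdorff_weight_ge0.
have wfin i : w i \is a fin_num.
  rewrite ge0_fin_numE// /w; apply: le_lt_trans (hausdorff_weight_le s0 (del0 i) _) _.
    by rewrite delE.
  by rewrite ltry.
have wdel i : del i ^+ d <= fine (w i).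
  rewrite -lee_fin fineK// /w /hausdorff_weight; case: ifPn => [/asboolP U0|_].
    suff -> : del i = 0 by rewrite expr0n eqn0Ngt d_gt0.
    apply/eqP; rewrite eq_le del0 andbT -lee_fin -delE U0.
    by apply: diameter_le.
  rewrite delE poweR_EFin lee_fin -powR_mulrn//.
  have := del0 i; rewrite le_eqVlt => /orP[/eqP<-|h].
    by rewrite powR0 ?powR_ge0// pnatr_eq0 -lt0n.
  by apply: ger_powR; [have := del4 i; lra|exact: ltW].
move=> Hsum.
have : kappa <= 2 ^+ d * \sum_(i < n) fine (w i) + m / 2.
  apply: le_trans Hsum _.
  apply: (@le_trans _ _ (\sum_(i < n) (2 ^+ d * fine (w i) + e i))); last first.
    by rewrite big_split/= -mulr_sumr lerD2l; exact: sume.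
  apply: ler_sum => i _; rewrite /del'.
  have [h|h] := leP (2 * del i) (e i).
    apply: (@le_trans _ _ (e i)).
      rewrite -{2}[e i]expr1 ler_wiXn2l//; [exact: ltW|].
      by apply: le_trans (e1 i) _; lra.
    rewrite lerDr mulr_ge0 ?exprn_ge0//.
    by apply: le_trans (wdel i); rewrite exprn_ge0.
  by rewrite exprMn ler_wpDr ?(ltW (e0 i))// ler_pM2l ?exprn_gt0.
move=> Hk; have {Hk} : b <= \sum_(i < n) fine (w i).
  by rewrite /b ler_pdivrMr ?exprn_gt0// mulrC; lra.
move=> bw; apply: (@le_trans _ _ (\sum_(0 <= i < n) w i)%E).
  rewrite big_mkord (eq_bigr (fun i : 'I_n => (fine (w i))%:E)); last first.
    by move=> i _; rewrite fineK.
  by rewrite sumEFin lee_fin.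
by apply: nneseries_lim_ge => i _ _; exact: w0.
Qed.

Lemma hausdorff_dim_transversal : hausdorff_dim dist Xi = (d%:R)%:E.
Proof.
apply/eqP; rewrite eq_le hausdorff_dim_le//=.
apply: le_ereal_inf_tmp => _ [s [s0 Hs] <-]; rewrite lee_fin leNgt.
by apply/negP => sd; exact: hausdorff_measure_neq0 s0 sd Hs.
Qed.

End HausdorffDimension.

(** * Bounds on complex powers *)

Lemma sum_subset_le (R : numDomainType) (I : eqType) (s s' : seq I) (f : I -> R) :
  uniq s -> uniq s' -> {subset s <= s'} -> (forall i, 0 <= f i) ->
  \sum_(i <- s) f i <= \sum_(i <- s') f i.
Proof.
move=> us us' ss' f0; rewrite [leRHS](bigID (mem s))/=.
have -> : \sum_(i <- s' | i \in s) f i = \sum_(i <- s) f i.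
  rewrite -big_filter; apply/perm_big/uniq_perm; rewrite ?filter_uniq//.
  move=> i; rewrite mem_filter; case: (boolP (i \in s)) => // /ss'.
  by rewrite andbC => ->.
by rewrite lerDl sumr_ge0.
Qed.

Section ElementaryBounds.
Variable R : realType.
Implicit Types x y : R.

Lemma expR_sub1_le x : `|expR x - 1| <= `|x| * expR `|x|.
Proof.
have h x' : expR x' - 1 <= x' * expR x'.
  have := expR_ge1Dx (- x'); rewrite -(ler_pM2r (expR_gt0 x')) -expRD addNr expR0.
  by rewrite mulrDl mul1r mulNr; lra.
have := expR_ge1Dx x; have [x0|x0] := leP 0 x => hx.
  by rewrite !ger0_norm ?h//; lra.
have e1 : 1 <= expR `|x|.
  by have := expR_ge1Dx `|x|; have := normr_ge0 x; lra.
have : expR x <= 1 by rewrite expR_le1 ltW.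
move=> hx1; rewrite ler0_norm; last lra.
apply: (@le_trans _ _ `|x|); last by rewrite ler_peMr.
by rewrite ltr0_norm//; lra.
Qed.

Lemma expR_sub1x_le x : `|expR x - 1 - x| <= x ^+ 2 * expR `|x|.
Proof.
have hx := expR_ge1Dx x.
have h1 : expR x - 1 - x <= x * (expR x - 1).
  have := expR_ge1Dx (- x); rewrite -(ler_pM2r (expR_gt0 x)) -expRD addNr expR0.
  by lra.
rewrite ger0_norm; last lra.
apply: le_trans h1 _; apply: le_trans (ler_norm _) _.
rewrite normrM -real_normK ?num_real// expr2 -mulrA.
by apply: ler_wpM2l => //; exact: expR_sub1_le.
Qed.

Lemma norm_sin_le x : `|sin x| <= `|x|.
Proof.
suff h y : 0 <= y -> `|sin y| <= y.
  have [x0|x0] := leP 0 x; first by rewrite (ger0_norm x0) h.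
  by rewrite (ltr0_norm x0) -normrN -sinN h//; lra.
move=> y0; have [|c _] := @MVT_segment R sin cos 0 y y0.
  exact/continuous_subspaceT/continuous_sin.
rewrite sin0 !subr0 => ->; rewrite normrM (ger0_norm y0).
by rewrite ler_piMl// cos_max.
Qed.

Lemma norm_cos_sub1_le x : `|cos x - 1| <= x ^+ 2 / 2.
Proof.
have -> : cos x - 1 = - (sin (x / 2) ^+ 2 *+ 2).
  rewrite {1}(_ : x = (x / 2) *+ 2); last by rewrite -mulr_natr; field.
  by rewrite cos_mulr2n cos2sin2; ring.
rewrite normrN ger0_norm; last by rewrite mulrn_wge0// sqr_ge0.
have : sin (x / 2) ^+ 2 <= (x / 2) ^+ 2.
  rewrite -[leLHS]real_normK ?num_real// -[leRHS]real_normK ?num_real//.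
  by rewrite lerXn2r ?nnegrE// norm_sin_le.
rewrite -[X in _ -> X <= _]mulr_natr; lra.
Qed.

Lemma norm_sin_subx_le x : `|sin x - x| <= x ^+ 2.
Proof.
suff h y : 0 <= y -> `|sin y - y| <= y ^+ 2.
  have [x0|x0] := leP 0 x; first exact: h.
  have -> : sin x - x = - (sin (- x) - (- x)) by rewrite sinN; ring.
  by rewrite normrN -sqrrN; apply: h; lra.
move=> y0; have [|c] := @MVT_segment R (sin - id) (cos - cst 1) 0 y y0.
  apply: continuous_subspaceT => z; apply: continuousB; first exact: continuous_sin.
  exact: cvg_id.
rewrite in_itv/= => /andP[c0 cy]; rewrite !fctE sin0 !subr0 => ->.
rewrite normrM (ger0_norm y0) expr2 ler_wpM2r//.
have := norm_cos_sub1_le c; have := cos_geN1 c; have := cos_le1 c => h1 h2.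
rewrite ler0_norm; last lra.
(* For [y <= 2] use [1 - cos c <= c ^+ 2 / 2 <= y]; for larger [y] use [1 - cos c <= 2]. *)
move=> h3; have [y2|y2] := leP y 2; last lra.
have : c ^+ 2 <= y * 2 by rewrite expr2; nra.
lra.
Qed.

Lemma sqr_le_expR x : 0 <= x -> x ^+ 2 <= 2 * expR x.
Proof.
move=> x0; have := expR_ge1Dxn 1 x0; rewrite (_ : 2`!%:R = 2 :> R)//.
by move=> h; have := expR_ge0 x; lra.
Qed.

End ElementaryBounds.

Section ComplexPower.
Variable R : realType.
Local Notation Re := complex.Re.
Local Notation Im := complex.Im.
Local Open Scope complex_scope.
Implicit Types (t : R) (s h z : R[i]).

Lemma cpowD t s h : cpow t (s + h) = cpow t s * cpow t h.
Proof.
case: s h => [a b] [a' b']; rewrite /cpow /= !mulrDl expRD cosD sinD.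
by apply/eqP; rewrite eq_complex /=; apply/andP; split; apply/eqP; ring.
Qed.

Lemma norm_cpow t s : 0 < t -> `|cpow t s| = (powR t (Re s))%:C.
Proof.
move=> t0; rewrite normc_def /cpow /=; congr (_ %:C).
rewrite !exprMn -mulrDr cos2Dsin2 mulr1 sqrtr_sqr ger0_norm ?expR_ge0//.
by rewrite /powR gt_eqF.
Qed.

Lemma cpow_real t (x : R) : 0 < t -> cpow t x%:C = (powR t x)%:C.
Proof.
by move=> t0; rewrite /cpow/= mul0r cos0 sin0 mulr0 mulr1 /powR gt_eqF.
Qed.

Lemma norm_le_ReIm (x y : R) : `|x +i* y| <= (`|x| + `|y|)%:C.
Proof.
rewrite normc_def /= lecR.
have xy0 : 0 <= `|x| + `|y| by rewrite addr_ge0.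
rewrite -[leRHS](ger0_norm xy0) -sqrtr_sqr ler_sqrt ?sqr_ge0//.
rewrite sqrrD !real_normK ?num_real// -addrA lerD2l lerDr.
by rewrite mulrn_wge0// mulr_ge0.
Qed.

(** A second-order Taylor remainder of [exp (h ln t)] at [h = 0], where [powR t (- del)] bounds the
    exponential of [|Re h * ln t|]. *)
Lemma cpow_sub1_le t h (del : R) : 0 < t -> t <= 1 -> `|Re h| <= del ->
  `|cpow t h - 1 - h * (ln t)%:C| <=
  (3 * (Re h ^+ 2 + Im h ^+ 2) * ln t ^+ 2 * powR t (- del))%:C.
Proof.
case: h => a b t0 t1 /= adel.
have l0 : ln t <= 0 by exact: ln_le0.
set l := ln t in l0 *; set m := powR t (- del).
pose x := a * l; pose y := b * l.
have xm : expR `|x| <= m.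
  rewrite /m /powR gt_eqF// -/l ler_expR /x normrM (ler0_norm l0).
  by rewrite mulrN mulNr lerN2 ler_wnM2r.
have m1 : 1 <= m by apply: le_trans xm; have := expR_ge1Dx `|x|; have := normr_ge0 x; lra.
have exm : expR x <= m by apply: le_trans xm; rewrite ler_expR ler_norm.
have -> : cpow t (a +i* b) - 1 - (a +i* b) * l%:C =
    (expR x * cos y - 1 - x) +i* (expR x * sin y - y).
  apply/eqP; rewrite /cpow /= -/l -/x -/y eq_complex /=.
  by apply/andP; split; apply/eqP; rewrite /x /y; ring.
apply: le_trans (norm_le_ReIm _ _) _; rewrite lecR.
have h1 : `|expR x * cos y - 1 - x| <= (x ^+ 2 + y ^+ 2) * m.
  have -> : expR x * cos y - 1 - x = (expR x - 1 - x) + expR x * (cos y - 1) by ring.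
  apply: le_trans (ler_normD _ _) _; rewrite mulrDl lerD//.
    apply: le_trans (expR_sub1x_le _) _.
    by rewrite ler_wpM2l// sqr_ge0.
  rewrite normrM (ger0_norm (expR_ge0 _)) mulrC ler_pM ?expR_ge0//.
  apply: le_trans (norm_cos_sub1_le _) _.
  by have := sqr_ge0 y; lra.
have h2 : `|expR x * sin y - y| <= (y ^+ 2 + `|x| * `|y|) * m.
  have -> : expR x * sin y - y = expR x * (sin y - y) + y * (expR x - 1) by ring.
  apply: le_trans (ler_normD _ _) _; rewrite mulrDl lerD//.
    rewrite normrM (ger0_norm (expR_ge0 _)) mulrC ler_pM ?expR_ge0//.
    exact: norm_sin_subx_le.
  rewrite normrM [leRHS]mulrAC [leLHS]mulrC ler_wpM2r//.
  apply: le_trans (expR_sub1_le _) _; exact: ler_wpM2l.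
have h3 : `|x| * `|y| <= x ^+ 2 + y ^+ 2.
  rewrite -[x ^+ 2]real_normK ?num_real// -[y ^+ 2]real_normK ?num_real//.
  by have := sqr_ge0 (`|x| - `|y|); have := sqr_ge0 (`|x| + `|y|); nra.
have -> : 3 * (a ^+ 2 + b ^+ 2) * l ^+ 2 * m = (3 * (x ^+ 2 + y ^+ 2)) * m.
  by rewrite /x /y; ring.
apply: (@le_trans _ _ ((x ^+ 2 + y ^+ 2 + (y ^+ 2 + (x ^+ 2 + y ^+ 2))) * m)).
  rewrite [leRHS]mulrDl lerD//; apply: le_trans h2 _.
  by rewrite ler_pM2r ?lerD2l//; lra.
rewrite ler_pM2r; last lra.
by have := sqr_ge0 x; lra.
Qed.

End ComplexPower.

(** * Unordered Dirichlet series *)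

#[local] Existing Instance totally_filter.

Section UnorderedSums.
Variables (R : realType) (I : choiceType).
Local Notation Re := complex.Re.
Local Notation Im := complex.Im.
Local Open Scope complex_scope.
Implicit Types (f g : I -> R[i]) (b : I -> R) (A B : {fset I}) (l : R[i]).

Lemma partial_sumE (V : zmodType) (f : I -> V) A :
  partial_sum f A = \sum_(i <- A) f i.
Proof. by rewrite /partial_sum (big_seq_fsetE _ _ predT f). Qed.

Lemma sum_fsubset_le b A B : (forall i, 0 <= b i) -> (A `<=` B)%fset ->
  \sum_(i <- A) b i <= \sum_(i <- B) b i.
Proof.
by move=> b0 /fsubsetP AB; apply: sum_subset_le; rewrite ?fset_uniq.
Qed.

(** Unordered summability with a real tolerance, whereas the neighbourhoods of [R[i]^o] are indexed
    by complex radii. *)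
Definition has_csum f l := forall e : R, 0 < e ->
  exists A0, forall A, (A0 `<=` A)%fset -> `|\sum_(i <- A) f i - l| < e%:C.

Lemma has_csum_cvg f l : has_csum f l ->
  partial_sum (f : I -> R[i]^o) @ totally --> (l : R[i]^o).
Proof.
move=> fl; apply/cvgrPdist_lt => e e0.
have eE : (Re e)%:C = e by apply: RRe_real; exact: gtr0_real.
have Re0 : 0 < Re e by rewrite -ltcR eE.
have [A0 HA0] := fl _ Re0; exists A0 => // A /= A0A.
by rewrite distrC partial_sumE -eE; exact: HA0.
Qed.

Lemma has_csum_sum f l : has_csum f l -> sum (f : I -> R[i]^o) = l.
Proof.
move=> fl; apply: cvg_lim; first exact: norm_hausdorff.
exact: has_csum_cvg.
Qed.

Lemma has_csumD f g l m : has_csum f l -> has_csum g m ->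
  has_csum (fun i => f i + g i) (l + m).
Proof.
move=> fl gm e e0; have e20 : 0 < e / 2 by rewrite divr_gt0.
have [A0 HA] := fl _ e20; have [B0 HB] := gm _ e20.
exists (A0 `|` B0)%fset => A; rewrite fsubUset => /andP[/HA hA /HB hB].
rewrite big_split/= opprD addrACA; apply: le_lt_trans (ler_normD _ _) _.
by rewrite [e]splitr rmorphD/=; apply: ltrD.
Qed.

Lemma has_csumZ f l (c : R[i]) : has_csum f l ->
  has_csum (fun i => c * f i) (c * l).
Proof.
move=> fl e e0; have [->|c0] := eqVneq c 0.
  exists fset0 => A _; rewrite big1 ?mul0r ?subrr ?normr0 ?ltcR// => i _.
  by rewrite mul0r.
have nE : (Re `|c|)%:C = `|c| by apply: RRe_real; exact: normr_real.
have n0 : 0 < Re `|c| by rewrite -ltcR nE normr_gt0.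
have [|A0 HA] := fl (e / Re `|c|); first by rewrite divr_gt0.
exists A0 => A /HA hA; rewrite -mulr_sumr -mulrBr normrM.
rewrite -nE -(divfK (lt0r_neq0 n0) e) mulrC rmorphM/= ltr_pM2r//.
by rewrite ltcR.
Qed.

Lemma has_csum_real b (M : R) : (forall i, 0 <= b i) ->
  (forall A, \sum_(i <- A) b i <= M) ->
  exists l : R, has_csum (fun i => (b i)%:C) l%:C.
Proof.
move=> b0 bM; pose E : set R := [set \sum_(i <- A) b i | A in [set: {fset I}]].
have supE : has_sup E.
  split; first by exists (\sum_(i <- fset0) b i), fset0.
  by exists M => _ [A _ <-].
exists (sup E) => e e0; have [_ [A0 _ <-] HA0] := sup_adherent e0 supE.
exists A0 => A A0A; rewrite -rmorph_sum/= -rmorphB/=.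
have := sum_fsubset_le b0 A0A.
have : \sum_(i <- A) b i <= sup E by apply: ub_le_sup; [exact: supE.2|exists A].
move=> h1 h2; rewrite normc_def /= expr0n addr0 sqrtr_sqr ltcR.
by rewrite ler0_norm; lra.
Qed.

(** The real and imaginary parts become nonnegative with bounded sums after adding [b], so they
    converge to suprema; the sum of [b] is then subtracted. *)
Lemma has_csum_dominated f b (M : R) : (forall i, `|f i| <= (b i)%:C) ->
  (forall A, \sum_(i <- A) b i <= M) -> exists l, has_csum f l.
Proof.
move=> fb bM.
have ReIm (z : R[i]) (r : R) : `|z| <= r%:C -> `|Re z| <= r /\ `|Im z| <= r.
  case: z => x y; rewrite normc_def /= lecR => h; split; apply: le_trans h.
    by rewrite -sqrtr_sqr ler_sqrt ?lerDl ?sqr_ge0// addr_ge0 ?sqr_ge0.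
  by rewrite -sqrtr_sqr ler_sqrt ?lerDr ?sqr_ge0// addr_ge0 ?sqr_ge0.
have b0 i : 0 <= b i by rewrite -lecR; apply: le_trans (fb i); exact: normr_ge0.
have [lb Hb] := has_csum_real b0 bM.
have bound (g : I -> R) : (forall i, `|g i| <= b i) ->
    exists l : R, has_csum (fun i => (b i + g i)%:C) l%:C.
  move=> gb; apply: (@has_csum_real _ (M + M)).
    by move=> i; have := gb i; rewrite ler_norml => /andP[h _]; lra.
  move=> A; rewrite big_split/= lerD//; apply: le_trans (bM A).
  by apply: ler_sum => i _; apply: le_trans (gb i); exact: ler_norm.
have [l1 H1] := bound (fun i => Re (f i)) (fun i => (ReIm _ _ (fb i)).1).
have [l2 H2] := bound (fun i => Im (f i)) (fun i => (ReIm _ _ (fb i)).2).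
have Hr := has_csumD H1 (has_csumZ (-1) Hb).
have Hi := has_csumZ 'i (has_csumD H2 (has_csumZ (-1) Hb)).
have := has_csumD Hr Hi; set l := (X in has_csum _ X) => H; exists l.
congr (has_csum _ _): H; apply/funext => i.
rewrite [RHS]complexE !mulN1r !rmorphD/=; congr (_ + _ * _).
  by rewrite addrAC subrr add0r.
by rewrite addrAC subrr add0r.
Qed.

Lemma has_csum_le f b (M : R) l : has_csum f l ->
  (forall i, `|f i| <= (b i)%:C) -> (forall A, \sum_(i <- A) b i <= M) ->
  `|l| <= M%:C.
Proof.
move=> fl fb bM.
have nE : (Re `|l|)%:C = `|l| by apply: RRe_real; exact: normr_real.
rewrite -nE lecR; apply/ler_addgt0Pr => e e0.
have [A HA] := fl e e0; rewrite -lecR nE.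
have -> : l = \sum_(i <- A) f i - (\sum_(i <- A) f i - l) by rewrite subKr.
apply: le_trans (ler_normB _ _) _; rewrite rmorphD/= lerD//; last first.
  by apply: ltW; apply: HA; rewrite fsubset_refl.
apply: le_trans (ler_norm_sum _ _ _) _.
apply: (@le_trans _ _ (\sum_(i <- A) (b i)%:C)); first exact: ler_sum.
by rewrite -rmorph_sum/= lecR.
Qed.

End UnorderedSums.

Lemma complex_ReD (R : rcfType) (x y : R[i]) :
  complex.Re (x + y) = complex.Re x + complex.Re y.
Proof. by case: x y => [a b] [c d]. Qed.

Lemma powRD_gt0 (R : realType) (t a b : R) :
  0 < t -> powR t (a + b) = powR t a * powR t b.
Proof. by move=> t0; rewrite powRD// (gt_eqF t0) implybT. Qed.

Section DirichletSeries.
Variables (R : realType) (I : choiceType) (w : I -> R) (s0 : R).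
Local Notation Re := complex.Re.
Local Notation Im := complex.Im.
Local Open Scope complex_scope.
Implicit Types (A : {fset I}) (s z h : R[i]).
Hypotheses (s0_gt0 : 0 < s0) (w_gt0 : forall i, 0 < w i) (w_le1 : forall i, w i <= 1).
Hypothesis bounded : forall sigma, s0 < sigma ->
  exists M, forall A, \sum_(i <- A) powR (w i) sigma <= M.
Hypothesis unbounded : forall M, exists A, M < \sum_(i <- A) powR (w i) s0.

Lemma zeta_has_csum s : s0 < Re s -> exists l, has_csum (zeta_term w s) l.
Proof.
move=> /bounded[M HM]; apply: has_csum_dominated HM => i.
by rewrite /zeta_term norm_cpow.
Qed.

Lemma zeta_csum s : s0 < Re s -> has_csum (zeta_term w s) (zeta w s).
Proof.
move=> hs; have [l Hl] := zeta_has_csum hs.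
by rewrite /zeta (has_csum_sum Hl).
Qed.

Lemma zeta_cvg s : half_plane s0 s -> cvg (partial_sum (zeta_term w s) @ totally).
Proof.
move=> /zeta_has_csum[l /has_csum_cvg]; exact: cvgP.
Qed.

(* The termwise derivative [ln (w i) * w i ^ z] dominates the difference
   quotient up to [|h|^2 * w i ^ (Re z - 2 del)], which is summable. *)
Lemma zeta_derivable z : half_plane s0 z -> derivable (zeta w) z 1.
Proof.
move=> zs; rewrite /half_plane/= in zs.
(* A quarter of the margin keeps [Re z - 2 * del] above [s0]: one [del] pays for the logarithms, the
   other for the variation of [h]. *)
pose del := (Re z - s0) / 4.
have del0 : 0 < del by rewrite divr_gt0// subr_gt0.
have [M HM] : exists M, forall A, \sum_(i <- A) powR (w i) (Re z - 2 * del) <= M.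
  by apply: bounded; rewrite /del; lra.
have l0 i : ln (w i) <= 0 by exact: ln_le0.
have expE i (r : R) : powR (w i) r = expR (r * ln (w i)) by rewrite /powR gt_eqF.
have sqrl i : ln (w i) ^+ 2 <= (2 / del ^+ 2) * powR (w i) (- del).
  have := @sqr_le_expR R (- del * ln (w i)); rewrite mulr_le0//; last lra.
  move=> /(_ isT); rewrite expE exprMn sqrrN => h.
  by rewrite mulrAC ler_pdivlMr ?exprn_gt0// mulrC.
have absl i : `|ln (w i)| <= del^-1 * powR (w i) (- del).
  have := expR_ge1Dx (- del * ln (w i)); rewrite expE => h.
  rewrite ler0_norm// ler_pdivlMl// mulrN -mulNr; lra.
have [D HD] : exists D, has_csum (fun i => (ln (w i))%:C * zeta_term w z i) D.
  apply: (@has_csum_dominated _ _ _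
      (fun i => del^-1 * powR (w i) (Re z - 2 * del)) (del^-1 * M)).
    move=> i; rewrite normrM /zeta_term norm_cpow//.
    have -> : `|(ln (w i))%:C| = (`|ln (w i)|)%:C :> R[i].
      by rewrite normc_def /= expr0n addr0 sqrtr_sqr.
    rewrite -rmorphM/= lecR.
    apply: (@le_trans _ _ (del^-1 * powR (w i) (- del) * powR (w i) (Re z))).
      by rewrite ler_wpM2r ?powR_ge0.
    rewrite -mulrA ler_wpM2l ?invr_ge0 ?(ltW del0)// -(powRD_gt0 _ _ (w_gt0 i)).
    by apply: ger_powR; [rewrite w_gt0 w_le1|lra].
  by move=> A; rewrite -mulr_sumr ler_wpM2l ?invr_ge0// ltW.
pose K := 6 / del ^+ 2 * M.
have M0 : 0 <= M by have := HM fset0; rewrite big_seq_fset0.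
have K0 : 0 <= K by rewrite mulr_ge0// divr_ge0// exprn_ge0// ltW.
have key h : `|h| < del%:C ->
    `|zeta w (h + z) - zeta w z - h * D| <= `|h| ^+ 2 * K%:C.
  move=> hdel.
  have Rehd : `|Re h| <= del.
    by rewrite -lecR; apply: le_trans (normc_ge_Re h) _; exact: ltW.
  have zh : s0 < Re (h + z).
    have : - del <= Re h by move: Rehd; rewrite ler_norml => /andP[].
    have : del = (Re z - s0) / 4 by [].
    by rewrite complex_ReD; lra.
  have H1 := zeta_csum zh; have H2 := has_csumZ (-1) (zeta_csum zs).
  have H3 := has_csumZ (- h) HD.
  have := has_csumD (has_csumD H1 H2) H3; rewrite !mulN1r mulNr => H.
  have hsq : `|h| ^+ 2 = (Re h ^+ 2 + Im h ^+ 2)%:C by rewrite add_Re2_Im2.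
  rewrite hsq -rmorphM/=.
  apply: (has_csum_le (b := fun i => (Re h ^+ 2 + Im h ^+ 2) *
     (6 / del ^+ 2 * powR (w i) (Re z - 2 * del))) H); last first.
    move=> A; rewrite -mulr_sumr ler_wpM2l ?addr_ge0 ?sqr_ge0// -mulr_sumr.
    by rewrite ler_wpM2l// divr_ge0// exprn_ge0// ltW.
  move=> i; rewrite /zeta_term addrC cpowD.
  have -> : - h * ((ln (w i))%:C * cpow (w i) z) +
      (cpow (w i) h * cpow (w i) z + -1 * cpow (w i) z) =
      (cpow (w i) h - 1 - h * (ln (w i))%:C) * cpow (w i) z by ring.
  rewrite normrM norm_cpow//.
  apply: (@le_trans _ _ ((3 * (Re h ^+ 2 + Im h ^+ 2) * ln (w i) ^+ 2 *
      powR (w i) (- del))%:C * (powR (w i) (Re z))%:C)).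
    apply: ler_wpM2r; first by rewrite ler0c powR_ge0.
    exact: cpow_sub1_le.
  rewrite -rmorphM/= lecR.
  have -> : Re z - 2 * del = Re z + (- del + - del) by ring.
  rewrite !(powRD_gt0 _ _ (w_gt0 i)).
  set q := powR (w i) (- del); set p := powR (w i) (Re z).
  have q0 : 0 <= q by exact: powR_ge0.
  have p0 : 0 <= p by exact: powR_ge0.
  set n2 := Re h ^+ 2 + Im h ^+ 2.
  have n20 : 0 <= n2 by rewrite addr_ge0 ?sqr_ge0.
  have -> : 3 * n2 * ln (w i) ^+ 2 * q * p = (3 * n2 * q * p) * ln (w i) ^+ 2 by ring.
  have -> : n2 * (6 / del ^+ 2 * (p * (q * q))) =
      (3 * n2 * q * p) * (2 / del ^+ 2 * q).
    by field; rewrite gt_eqF.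
  by rewrite ler_wpM2l// !mulr_ge0.
apply/cvg_ex; exists (D : R[i]^o); apply/cvgrPdist_lt => e e0.
have eE : (Re e)%:C = e by apply: RRe_real; exact: gtr0_real.
have Re0 : 0 < Re e by rewrite -ltcR eE.
pose rad := Num.min del (Re e / (K + 1)).
have K10 : 0 < K + 1 by lra.
have rad0 : 0 < rad by rewrite lt_min del0 divr_gt0.
apply/nbhs_ballP; exists (rad%:C); first by rewrite /= ltcR.
move=> h; rewrite -ball_normE/= sub0r normrN => hrad hneq.
have hdel : `|h| < del%:C.
  by apply: lt_le_trans hrad _; rewrite lecR ge_min lexx.
have hn0 : 0 < `|h| by rewrite normr_gt0.
rewrite -(ltr_pM2l hn0) -normrM mulrBr.
have -> : h * (h^-1 *: (zeta w (h *: (1 : R[i]^o) + z) - zeta w z)) =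
    zeta w (h + z) - zeta w z.
  rewrite -[h^-1 *: _]/(h^-1 * _) mulrA divff// mul1r.
  by rewrite -[h *: _]/(h * 1) mulr1.
rewrite distrC; apply: le_lt_trans (key h hdel) _.
rewrite expr2 -mulrA ltr_pM2l//.
apply: (@le_lt_trans _ _ (rad%:C * K%:C)).
  by apply: ler_wpM2r; [rewrite ler0c|exact: ltW].
rewrite -eE -rmorphM/= ltcR.
apply: (@le_lt_trans _ _ (Re e / (K + 1) * K)).
  by rewrite ler_wpM2r// ge_min lexx orbT.
by rewrite mulrAC ltr_pdivrMr// ltr_pM2l//; lra.
Qed.

Lemma half_plane_open (s1 : R) : open (half_plane s1).
Proof.
rewrite openE => z zs; apply/nbhs_ballP.
rewrite /half_plane/= in zs.
exists ((Re z - s1)%:C); first by rewrite /= ltcR subr_gt0.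
move=> y; rewrite -ball_normE/= => yz; rewrite /half_plane/=.
have : `|Re (z - y)| < Re z - s1.
  by rewrite -ltcR; apply: le_lt_trans (normc_ge_Re _) yz.
case: (z) (y) => a b [a' b'] /=; rewrite ltr_norml => /andP[_]; lra.
Qed.

Lemma zeta_not_cvg : ~ cvg (partial_sum (zeta_term w s0%:C) @ totally).
Proof.
move=> /cvg_ex[l /cvgrPdist_lt H]; have [A0 _ HA0] := H 1 ltr01.
have nE : (Re `|l|)%:C = `|l| by apply: RRe_real; exact: normr_real.
have [A HA] := unbounded (Re `|l| + 1).
have := HA0 (A `|` A0)%fset (fsubsetUr _ _).
rewrite /= partial_sumE; set T := (X in l - X) => lT.
have TE : T = (\sum_(i <- (A `|` A0)%fset) powR (w i) s0)%:C.
  by rewrite rmorph_sum/=; apply: eq_bigr => i _; rewrite /zeta_term cpow_real.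
have T0 : 0 <= T by rewrite TE lecR sumr_ge0// => i _; exact: powR_ge0.
have : T < `|l| + 1.
  rewrite -(ger0_norm T0).
  have -> : T = l - (l - T) by rewrite subKr.
  by apply: le_lt_trans (ler_normB _ _) _; rewrite ltrD2l.
apply/negP; rewrite -real_leNgt ?ger0_real// ?addr_ge0//.
rewrite -nE -[1]/(1%:C) -rmorphD/= TE lecR; apply: le_trans (ltW HA) _.
by apply: sum_fsubset_le => [i|]; [exact: powR_ge0|exact: fsubsetUl].
Qed.

(** An extension would be bounded near [s0], while a large finite partial sum at [s0] remains large
    at [s0 + t] for small [t]. *)
Lemma zeta_no_extension : ~ exists (U : set R[i]^o) (f : R[i]^o -> R[i]^o),
  [/\ open U, U s0%:C, holomorphic_on U f
    & forall s, U s -> half_plane s0 s -> f s = zeta w s].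
Proof.
move=> [U [f [Uo Us0 fhol fE]]].
have /derivable1_diffP/differentiable_continuous/cvgrPdist_lt := fhol _ Us0.
move=> /(_ 1 ltr01) near_f.
have near_U : nbhs (s0%:C : R[i]^o) U by exact: open_nbhs_nbhs.
have : nbhs (s0%:C : R[i]^o) ([set t | `|f s0%:C - f t| < 1] `&` U).
  exact: filterI.
move=> /nbhs_ballP[e e0 He].
have eE : (Re e)%:C = e by apply: RRe_real; exact: gtr0_real.
have Re0 : 0 < Re e by rewrite -ltcR eE.
pose M := Re `|f s0%:C| + 1.
have nE : (Re `|f s0%:C|)%:C = `|f s0%:C| by apply: RRe_real; exact: normr_real.
have [A HA] := unbounded (2 * M).
pose L := 1 + \sum_(i <- A) `|ln (w i)|.
have L1 : 1 <= L by rewrite lerDl sumr_ge0.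
(* With this [t], [w i ^ t >= 1 + t * ln (w i) >= 1/2] for every [i] in [A], so passing from [s0] to
   [s0 + t] at most halves the partial sum. *)
pose t := Num.min (Re e / 2) (2 * L)^-1.
have t0 : 0 < t by rewrite lt_min divr_gt0// invr_gt0; lra.
have tL : t * L <= 2^-1.
  rewrite -ler_pdivlMr; last lra.
  by rewrite -invfM ge_min lexx orbT.
have [fs Us] : (`|f s0%:C - f (s0 + t)%:C| < 1) /\ U (s0 + t)%:C.
  apply: He; rewrite -ball_normE/= rmorphD/= opprD addrA subrr sub0r normrN.
  rewrite normc_def /= expr0n addr0 sqrtr_sqr (gtr0_norm t0) -eE ltcR.
  by rewrite gt_min; apply/orP; left; lra.
have hs : s0 < Re (s0 + t)%:C by rewrite /= ltrDl.
have := zeta_csum hs; rewrite -fE// => H.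
have half : M < \sum_(i <- A) powR (w i) (s0 + t).
  apply: (@lt_le_trans _ _ (\sum_(i <- A) 2^-1 * powR (w i) s0)).
    by rewrite -mulr_sumr; lra.
  rewrite big_seq [leRHS]big_seq; apply: ler_sum => i iA.
  rewrite (powRD_gt0 _ _ (w_gt0 i)) mulrC ler_wpM2l ?powR_ge0//.
  rewrite /powR gt_eqF//; apply: le_trans (expR_ge1Dx _).
  have : `|t * ln (w i)| <= 2^-1.
    apply: le_trans tL; rewrite normrM (gtr0_norm t0) ler_pM2l//.
    rewrite /L (big_fsetD1 i)//= addrCA lerDl addr_ge0// sumr_ge0//.
  by rewrite ler_norml => /andP[h _]; lra.
have [|A0 HA0] := H (\sum_(i <- A) powR (w i) (s0 + t) - M).
  by rewrite subr_gt0.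
have := HA0 (A `|` A0)%fset (fsubsetUr _ _).
set T := (X in X - _) => TF.
have TE : T = (\sum_(i <- (A `|` A0)%fset) powR (w i) (s0 + t))%:C.
  by rewrite rmorph_sum/=; apply: eq_bigr => i _; rewrite /zeta_term cpow_real.
have T0 : 0 <= T by rewrite TE lecR sumr_ge0// => i _; exact: powR_ge0.
have fM : `|f (s0 + t)%:C| < M%:C.
  have -> : f (s0 + t)%:C = f s0%:C - (f s0%:C - f (s0 + t)%:C) by rewrite subKr.
  apply: le_lt_trans (ler_normB _ _) _.
  have -> : M%:C = `|f s0%:C| + 1.
    by rewrite /M (rmorphD (real_complex R)); congr (_ + _); exact: nE.
  by rewrite ltrD2l.
have : T < (\sum_(i <- A) powR (w i) (s0 + t))%:C.
  rewrite -(ger0_norm T0).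
  rewrite -[T](subrK (f (s0 + t)%:C)); apply: le_lt_trans (ler_normD _ _) _.
  have -> : (\sum_(i <- A) powR (w i) (s0 + t))%:C =
      (\sum_(i <- A) powR (w i) (s0 + t) - M)%:C + M%:C.
    by rewrite -(rmorphD (real_complex R)) subrK.
  exact: ltrD.
rewrite TE ltcR ltNge sum_fsubset_le ?fsubsetUl// => i; exact: powR_ge0.
Qed.

Lemma dirichlet_abscissa : is_abscissa w s0.
Proof.
split=> //; first exact: zeta_cvg.
  exact: zeta_derivable.
exact: zeta_no_extension.
Qed.

(** A smaller abscissa would give convergence at [s0]; at a larger one the zeta-function itself is a
    holomorphic extension. *)
Lemma dirichlet_abscissa_uniq (s1 : R) : is_abscissa w s1 -> s1 = s0.
Proof.
move=> [s10 s1cvg _ s1sing].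
have [s1s0|s0s1|//] := ltgtP s1 s0.
  by case: zeta_not_cvg; apply: s1cvg.
case: s1sing; exists (half_plane s0), (zeta w); split=> //.
- exact: half_plane_open.
- exact: zeta_derivable.
Qed.

End DirichletSeries.

(** * Paths in the Bratteli diagram *)

Section PathSums.
Variables (R : realType) (d k : nat) (A : 'M[nat]_k).
Variables (Lambda : R) (nu : 'cV[R]_k).
Local Notation edge := (edge A).
Implicit Types (p q : 'I_k) (es : seq edge).
Hypotheses (d_gt0 : (0 < d)%N) (Lambda_gt1 : 1 < Lambda).
Hypotheses (nu_gt0 : forall p, 0 < nu p ord0) (nu_sum1 : \sum_p nu p ord0 = 1).
Hypothesis nu_eigen : forall p, \sum_q nu q ord0 *+ A p q = Lambda * nu p ord0.
Local Notation diam := (@path_diam k A R d Lambda nu).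

Fixpoint edge_paths m p : seq (seq edge) :=
  if m is m'.+1 then
    [seq e :: es | e <- [seq e <- enum {: edge} | edge_src e == p],
                   es <- edge_paths m' (edge_tgt e)]
  else [:: [::]].

Lemma mem_edge_paths m p es :
  (es \in edge_paths m p) = composable p es && (size es == m).
Proof.
elim: m p es => [|m ih] p es.
  by rewrite inE; case: es => // e es; rewrite andbF.
apply/allpairsPdep/idP => [[e [es' [ep es'm ->]]]|].
  move: ep es'm; rewrite mem_filter ih /= => /andP[-> _] /andP[-> /eqP->].
  by rewrite eqxx.
case: es => [|e es] //= /andP[/andP[ep ces]]; rewrite eqSS => sz.
by exists e, es; rewrite mem_filter ep mem_enum ih ces sz.
Qed.

Lemma uniq_edge_paths m p : uniq (edge_paths m p).
Proof.
elim: m p => //= m ih p; apply: allpairs_uniq_dep => //.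
- exact/filter_uniq/enum_uniq.
- by move=> [e es] [e' es'] _ _ [-> ->].
Qed.

Lemma sum_edges (V : nmodType) (g : 'I_k -> V) p :
  \sum_(e <- enum {: edge} | edge_src e == p) g (edge_tgt e) = \sum_q g q *+ A p q.
Proof.
rewrite big_enum_cond/=.
transitivity (\sum_(e : {pq : 'I_k * 'I_k & 'I_(A pq.1 pq.2)} | (tag e).1 == p)
    g (tag e).2); first by apply: eq_bigl => e.
rewrite (eq_bigl (fun e : {pq : 'I_k * 'I_k & 'I_(A pq.1 pq.2)} =>
    ((tag e).1 == p) && true)); last by move=> e; rewrite andbT.
rewrite -(sig_big_dep (fun pq : 'I_k * 'I_k => pq.1 == p) (fun _ => predT)
  (fun pq (_ : 'I_(A pq.1 pq.2)) => g pq.2))/=.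
transitivity (\sum_(pq : 'I_k * 'I_k | (pq.1 == p) && true) g pq.2 *+ A pq.1 pq.2).
  by apply: eq_big => [pq|pq _]; [rewrite andbT|rewrite sumr_const card_ord].
by rewrite -(pair_big (pred1 p) predT (fun p q => g q *+ A p q))/= big_pred1_eq.
Qed.

Definition path_end p es : 'I_k := last p (map (@edge_tgt k A) es).

Lemma sum_edge_paths m p :
  \sum_(es <- edge_paths m p) nu (path_end p es) ord0 = Lambda ^+ m * nu p ord0.
Proof.
elim: m p => [|m ih] p; first by rewrite big_seq1 mul1r.
rewrite /= big_allpairs_dep/= big_filter.
rewrite (eq_bigr (fun e => Lambda ^+ m * nu (edge_tgt e) ord0)); last first.
  by move=> e _; exact: ih.
rewrite (sum_edges (fun q => Lambda ^+ m * nu q ord0)).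
rewrite exprSr -mulrA -nu_eigen mulr_sumr.
by apply: eq_bigr => q _; rewrite mulrnAr.
Qed.

Definition rooted_paths m : seq ('I_k * seq edge) :=
  [seq (p, es) | p <- enum 'I_k, es <- edge_paths m p].

Lemma mem_rooted_paths m (x : 'I_k * seq edge) :
  (x \in rooted_paths m) = composable x.1 x.2 && (size x.2 == m).
Proof.
case: x => p es; apply/allpairsPdep/idP => [[q [es' [_ + [-> ->]]]]|H].
  by rewrite mem_edge_paths.
by exists p, es; rewrite mem_enum mem_edge_paths.
Qed.

Lemma uniq_rooted_paths m : uniq (rooted_paths m).
Proof.
apply: allpairs_uniq_dep; first exact: enum_uniq.
- by move=> p _; exact: uniq_edge_paths.
- by move=> [p es] [q es'] _ _ [-> ->].
Qed.

Lemma sum_rooted_paths m :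
  \sum_(x <- rooted_paths m) nu (path_end x.1 x.2) ord0 = Lambda ^+ m.
Proof.
rewrite big_allpairs_dep/= big_enum/=.
under eq_bigr => p _ do rewrite sum_edge_paths.
by rewrite -mulr_sumr nu_sum1 mulr1.
Qed.

Definition path_weight (sigma : R) (x : 'I_k * seq edge) : R :=
  powR (nu (path_end x.1 x.2) ord0) (sigma / d%:R) *
  powR Lambda (- ((size x.2).+1%:R * (sigma / d%:R))).

Lemma Lambda_gt0 : 0 < Lambda.
Proof. exact: lt_trans Lambda_gt1. Qed.

Lemma nu_le1 p : nu p ord0 <= 1.
Proof. by rewrite -nu_sum1 (bigD1 p)//= lerDl sumr_ge0// => q _; exact: ltW. Qed.

Lemma powR_path_diam (sigma : R) (h : {g : 'I_k * seq edge | composable g.1 g.2}) :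
  powR (diam (Some h)) sigma = path_weight sigma (val h).
Proof.
case: h => -[p es] c /=; rewrite powRM ?powR_ge0// -!powRrM /path_weight/=.
by congr (powR _ _ * powR _ _); rewrite /path_end; ring.
Qed.

Lemma path_diam_gt0 g : 0 < diam g.
Proof.
case: g => [[[p es] c]|] //=.
by rewrite mulr_gt0// powR_gt0// Lambda_gt0.
Qed.

Lemma path_diam_le1 g : diam g <= 1.
Proof.
case: g => [[[p es] c]|] //=; rewrite -[leRHS]mulr1 ler_pM ?powR_ge0//.
  set x := nu _ _; apply: (@le_trans _ _ (powR x 0)); last by rewrite powRr0.
  by apply: ger_powR; rewrite ?nu_gt0 ?nu_le1// divr_ge0.
apply: (@le_trans _ _ (powR Lambda 0)); last by rewrite powRr0.
by apply: ler_powR; [exact: ltW|rewrite oppr_le0 divr_ge0].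
Qed.

(** Finite lists exhausting all paths. The cutoff is on the edges after the root edge, so the
    nonempty paths listed have at most [n] edges in all. *)
Definition short_paths n : seq (bpath A) :=
  None :: map Some (pmap insub (flatten (map rooted_paths (iota 0 n)))).

Lemma mem_short_paths n g :
  (if g is Some h then size (val h).2 < n else true)%N -> g \in short_paths n.
Proof.
case: g => [h|_]; last by rewrite inE.
move=> hn; rewrite inE/= mem_map; last by move=> ? ? [].
rewrite mem_pmap_sub; apply/flatten_mapP; exists (size (val h).2).
  by rewrite mem_iota.
by rewrite mem_rooted_paths eqxx andbT; exact: valP h.
Qed.

Lemma uniq_short_paths n : uniq (short_paths n).
Proof.
rewrite /= map_inj_uniq; last by move=> ? ? [].
apply/andP; split; first by apply/mapP => -[].
apply: pmap_sub_uniq; elim: n 0%N => //= n ih i.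
rewrite cat_uniq uniq_rooted_paths ih andbT/=; apply/hasPn => x.
move=> /flatten_mapP[j]; rewrite mem_iota => /andP[ij _].
rewrite !mem_rooted_paths => /andP[_ /eqP->].
by rewrite (gtn_eqF ij) andbF.
Qed.

Lemma sum_short_paths (sigma : R) n :
  \sum_(g <- short_paths n) powR (diam g) sigma =
  1 + \sum_(m <- iota 0 n) \sum_(x <- rooted_paths m) path_weight sigma x.
Proof.
rewrite big_cons big_map powR1; congr (_ + _).
under eq_bigr => h _ do rewrite powR_path_diam.
rewrite -(big_map val predT (path_weight sigma)) (pmap_filter (insubK _)).
have -> : [seq x <- flatten (map rooted_paths (iota 0 n)) |
    isSome (insub x : option {g : 'I_k * seq edge | composable g.1 g.2})] =
    flatten (map rooted_paths (iota 0 n)).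
  apply/all_filterP/allP => x /flatten_mapP[m _].
  by rewrite mem_rooted_paths => /andP[cx _]; rewrite insubT.
by rewrite big_flatten big_map.
Qed.

(** As [nu <= 1], its power [th > 1] is at most [nu], and the eigenvector equation bounds the paths
    with [m] edges after the root edge by [Lambda ^ (m (1 - th))], a convergent geometric series. *)
Lemma path_diam_bounded (sigma : R) : d%:R < sigma ->
  exists M, forall B : {fset bpath A}, \sum_(g <- B) powR (diam g) sigma <= M.
Proof.
move=> ds; have dR : 0 < d%:R :> R by rewrite ltr0n.
pose th := sigma / d%:R.
have th1 : 1 < th by rewrite ltr_pdivlMr// mul1r.
pose q := powR Lambda (1 - th).
have q0 : 0 <= q by exact: powR_ge0.
have q1 : q < 1.
  rewrite /q /powR gt_eqF ?Lambda_gt0// expR_lt1 pmulr_llt0 ?ln_gt0//.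
  by rewrite subr_lt0.
have level m : \sum_(x <- rooted_paths m) path_weight sigma x <= q ^+ m.
  apply: (@le_trans _ _ (\sum_(x <- rooted_paths m) nu (path_end x.1 x.2) ord0 *
      powR Lambda (- (m.+1%:R * th)))).
    rewrite big_seq [leRHS]big_seq; apply: ler_sum => x.
    rewrite mem_rooted_paths => /andP[_ /eqP sx].
    rewrite /path_weight sx ler_wpM2r ?powR_ge0//.
    by apply: ge1r_powR; rewrite ?nu_gt0 ?nu_le1// ltW.
  rewrite -mulr_suml sum_rooted_paths -!powR_mulrn ?powR_ge0 ?(ltW Lambda_gt0)//.
  rewrite -(powRD_gt0 _ _ Lambda_gt0) -powRrM.
  apply: ler_powR; first exact: ltW.
  by rewrite -natr1; have : 0 <= m%:R :> R by []; nra.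
have geom n : (1 - q) * \sum_(m <- iota 0 n) q ^+ m = 1 - q ^+ n.
  elim: n => [|n ih]; first by rewrite big_nil expr0 mulr0 subrr.
  rewrite -[n.+1]addn1 iotaD big_cat/= big_seq1 mulrDr ih add0n addn1 exprS.
  by ring.
exists (1 + (1 - q)^-1) => B.
pose n := (\max_(g <- B) (if g is Some h then (size (val h).2).+1 else 0))%N.
apply: (@le_trans _ _ (\sum_(g <- short_paths n) powR (diam g) sigma)).
  apply: sum_subset_le; rewrite ?fset_uniq ?uniq_short_paths//.
    move=> g gB; apply: mem_short_paths.
    have : ((if g is Some h then (size (val h).2).+1 else 0) <= n)%N.
      by apply: (leq_bigmax_seq _ gB).
    by case: (g).
  by move=> g; exact: powR_ge0.
rewrite sum_short_paths lerD2l; apply: le_trans (ler_sum _ (fun m _ => level m)) _.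
rewrite -[leRHS]mulr1 ler_pdivlMl; last by rewrite subr_gt0.
by rewrite geom gerBl exprn_ge0.
Qed.

(** At exponent [d] the weights [nu] of the endpoints sum to [Lambda ^ m] against a factor
    [Lambda ^ (- (m + 1))], so every level contributes exactly [1 / Lambda]. *)
Lemma path_diam_unbounded (M : R) :
  exists B : {fset bpath A}, M < \sum_(g <- B) powR (diam g) d%:R.
Proof.
have dR : d%:R != 0 :> R by rewrite pnatr_eq0 -lt0n.
have level m : \sum_(x <- rooted_paths m) path_weight d%:R x = Lambda^-1.
  transitivity (\sum_(x <- rooted_paths m)
      nu (path_end x.1 x.2) ord0 * (Lambda ^+ m.+1)^-1).
    rewrite big_seq [RHS]big_seq; apply: eq_bigr => x.
    rewrite mem_rooted_paths => /andP[_ /eqP sx].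
    rewrite /path_weight sx divff// mulr1 powRr1 ?(ltW (nu_gt0 _))// powRN.
    by rewrite powR_mulrn// ltW ?Lambda_gt0.
  rewrite -mulr_suml sum_rooted_paths exprSr invfM mulrA divff ?mul1r//.
  by rewrite expf_neq0// gt_eqF ?Lambda_gt0.
pose n := (Num.truncn (`|M| * Lambda)).+1.
exists [fset g | g in short_paths n]%fset.
apply: (@lt_le_trans _ _ (\sum_(g <- short_paths n) powR (diam g) d%:R)).
  rewrite sum_short_paths (eq_bigr (fun=> Lambda^-1)); last by move=> m _; exact: level.
  rewrite big_const_seq count_predT size_iota iter_addr_0 -mulr_natl.
  apply: (@lt_trans _ _ (n%:R * Lambda^-1)); last by rewrite ltrDr.
  rewrite ltr_pdivlMr ?Lambda_gt0//; apply: le_lt_trans (truncnS_gt _).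
  by rewrite ler_pM2r ?Lambda_gt0// ler_norm.
apply: sum_subset_le; rewrite ?fset_uniq ?uniq_short_paths//.
  by move=> g gn; rewrite in_fset.
by move=> g; exact: powR_ge0.
Qed.

End PathSums.

(** * Abscissa and dimension combined *)

Theorem theorem4p1 (R : realType) (d k : nat) (S : substitution R d k)
    (Lambda : R) (nu : 'cV[R]_k)
    (d_gt0 : (0 < d)%N)
    (Sprim : primitive_subst S)
    (Saper : aperiodic_subst S)
    (Sflc : finite_local_complexity S)
    (PF : perron_data (subst_matrix S) Lambda nu) :
  let diam := @path_diam k (subst_matrix S) R d Lambda nu in
  exists s0 : R,
    [/\ is_abscissa diam s0,
        forall s1, is_abscissa diam s1 -> s1 = s0,
        s0%:E = hausdorff_dim (transversal_dist S) (canonical_transversal S)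
      & hausdorff_dim (transversal_dist S) (canonical_transversal S)
        = (d%:R)%:E].
Proof.
move=> diam; have k_gt0 := perron_size_gt0 PF.
have Lambda_gt1 : 1 < Lambda.
  by rewrite (perron_eigenvalueE PF) exprn_egt1 ?expansion_gt1// -lt0n.
have nu_gt0 := perron_gt0 PF; have nu_sum1 := perron_sum1 PF.
have nu_eigen := perron_eigenvector PF.
have dimE := hausdorff_dim_transversal d_gt0 k_gt0 Sprim Sflc Saper.
have dR : 0 < d%:R :> R by rewrite ltr0n.
have diam_gt0 := path_diam_gt0 (A := subst_matrix S) d Lambda_gt1 nu_gt0.
have diam_le1 := path_diam_le1 (A := subst_matrix S) d Lambda_gt1 nu_gt0 nu_sum1.
have bnd := path_diam_bounded d_gt0 Lambda_gt1 nu_gt0 nu_sum1 nu_eigen.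
have unb := path_diam_unbounded d_gt0 Lambda_gt1 nu_gt0 nu_sum1 nu_eigen.
exists d%:R; split=> //.
- exact: dirichlet_abscissa.
- by move=> s1; apply: dirichlet_abscissa_uniq.
Qed.
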